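(* Let $k$ be a positive integer, let $\Lambda\subset\mathbb{R}^p$ and $\mathcal{D}_i\subset\mathbb{R}^{d_i}$ ($1\le i\le k$) be separable, complete metric spaces with their Borel $\sigma$-algebras, let $\phi_i:\Lambda\to\mathcal{D}_i$ be measurable, let $P_{\text{obs},i}$ be a probability measure on $\mathcal{D}_i$ for each $i$, and let $P^0=P_{\text{init}}$ be a probability measure on $\Lambda$. Let $$\mathbb{P}=\bigcap_{i=1}^k\{P \text{ a probability measure on }\Lambda\,:\,P\ll P_{\text{init}},\ P\circ\phi_i^{-1}=P_{\text{obs},i}\},$$ and let $(P^n)_{n\ge0}$ be the iterative DCI sequence started at $P^0$ (defined in the context). Suppose there exists at least one $P\in\mathbb{P}$ with $P\ll P^0$ and $\inf_{P\in\mathbb{P}}KL(P\,\|\,P^0)<\infty$. Suppose further that there exists a constant $C$ such that for every $1\le i\le k$, $$\frac1C\le\frac{dP_{\text{obs},i}}{dQ^0_i}\le C,\qquad Q^0_i:=P^0\circ\phi_i^{-1}$$ (almost everywhere). Then $P^n$ converges in total variation to some $P^\infty\in\mathbb{P}$, where $P^\infty$ is the information projection (I-projection) of $P^0$ onto $\mathbb{P}$, i.e. $$P^\infty=\operatorname{arg\,min}_{P\in\mathbb{P}}KL(P\,\|\,P^0).$$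
   Context: Iterative DCI sequence: $P^0=P_{\text{init}}$. For $n\ge1$, let $i\in\{1,\dots,k\}$ be the index with $n\equiv i\pmod k$ (so the constraints are cycled through in the order $1,2,\dots,k,1,2,\dots$). Let $Q^{n-1}_i:=P^{n-1}\circ\phi_i^{-1}$ and let $\{P^{n-1}_{\omega,i}\}_{\omega\in\mathcal{D}_i}$ be the disintegration of $P^{n-1}$ through $\phi_i$: the $Q^{n-1}_i$-a.e. unique measurable family of probability measures on $\Lambda$, with $P^{n-1}_{\omega,i}$ concentrated on $\phi_i^{-1}(\omega)$ for $Q_i^{n-1}$-a.e. $\omega$, such that $P^{n-1}(\cdot)=\int_{\mathcal{D}_i}P^{n-1}_{\omega,i}(\cdot)\,dQ^{n-1}_i(\omega)$. Then $$P^n(\cdot):=\int_{\mathcal{D}_i}P^{n-1}_{\omega,i}(\cdot)\,dP_{\text{obs},i}(\omega).$$ $KL(P\,\|\,Q)=\int\log\frac{dP}{dQ}\,dP$ for $P\ll Q$ is the Kullback–Leibler divergence. *)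

(* Defs.v *)
From HB Require Import structures.
From mathcomp Require Import all_boot all_order all_algebra.
From mathcomp Require Import all_classical all_reals all_analysis.

Set Implicit Arguments.
Unset Strict Implicit.
Unset Printing Implicit Defensive.

Import Order.TTheory GRing.Theory Num.Theory.
Import numFieldNormedType.Exports.

Local Open Scope classical_set_scope.
Local Open Scope ring_scope.
Local Open Scope charge_scope.
Local Open Scope ereal_scope.

#[short(type="completeMetricType")]
HB.structure Definition CompleteMetric (R : numDomainType) :=
  {T of Complete T & Metric R T}.

Definition separable (T : topologicalType) :=
  exists2 S : set T, countable S & dense S.

(* [f] identifies [S] with a subspace of [T]: the topology of [S] is the one
   that [T] induces through [f]. For [T := 'rV[R]_n] this renders "S is a subset
   of R^n", the (complete) metric of [S] being any metric compatible with the
   subspace topology, for instance the restriction of the one of R^n. *)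
Definition embedding (S T : topologicalType) (f : S -> T) :=
  injective f /\
  forall U : set S, open U <-> exists2 V : set T, open V & f @^-1` V = U.

Notation borel T := (g_sigma_algebraType (@open T)).

Section KullbackLeibler.
Context d (T : measurableType d) (R : realType).
Implicit Types (P Q : probability T R) (S : set (probability T R)).

(* The value outside of [P `<< Q] is the usual convention. *)
Definition KL P Q : \bar R :=
  if `[< P `<< Q >] then
    \int[P]_x lne (('d (charge_of_finite_measure P) '/d Q) x)
  else +oo.

(* Uniqueness can only be asked on measurable sets: the values of a measure on
   the other sets are unspecified. *)
Definition is_Iprojection S Q (P : probability T R) :=
  [/\ S P,
      forall P', S P' -> KL P Q <= KL P' Q &
      forall P', S P' -> KL P' Q <= KL P Q ->
        forall A, measurable A -> P' A = P A].

Definition tv_dist P Q : \bar R :=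
  ereal_sup [set `|P A - Q A| | A in measurable].

End KullbackLeibler.

Section Disintegration.
Context d d' (T : measurableType d) (D : measurableType d') (R : realType).

Definition disintegration (P : probability T R) (phi : {mfun T >-> D})
    (K : R.-pker D ~> T) :=
  {ae distribution P phi, forall w, K w (~` (phi @^-1` [set w])) = 0} /\
  forall A, measurable A -> P A = \int[distribution P phi]_w K w A.

Definition DCI_update (phi : {mfun T >-> D}) (Pobs : probability D R)
    (P P' : probability T R) :=
  exists2 K : R.-pker D ~> T, disintegration P phi K &
    forall A, measurable A -> P' A = \int[Pobs]_w K w A.

End Disintegration.

Section IterativeDCI.
Context d (T : measurableType d) (R : realType) (k : nat)
  (dD : 'I_k -> measure_display) (D : forall i, measurableType (dD i)).
Variables (phi : forall i, {mfun T >-> D i}) (Pobs : forall i, probability (D i) R)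
  (Pinit : probability T R).

Definition feasible : set (probability T R) :=
  [set P : probability T R | P `<< Pinit /\
     forall i B, measurable B -> distribution P (phi i) B = Pobs i B].

(* The constraints are numbered from 0 here, hence [i.+1]. *)
Definition iterative_DCI (P : nat -> probability T R) :=
  P 0%N = Pinit /\
  forall (n : nat) (i : 'I_k), n.+1 = i.+1 %[mod k] ->
    DCI_update (phi i) (Pobs i) (P n) (P n.+1).

End IterativeDCI.

(* Main.v *)
(* Write p_n = dP^n/dP^0 as the product over m < n of exp(g_m), where g_m is a
   function of the map constrained at step m. The integral eps_m of g_m is the
   same under P^(m+1) and under every feasible law P, and the partial sums
   S_n = KL(P||P^0) - KL(P||P^n) of the eps_m are bounded by KL(P||P^0).
   Moreover eps_m dominates the squared Hellinger distance of P^m and P^(m+1).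

   In p_(N+k), replace the last k factors exp(g_m) by exp(min(g_m, 1)): each
   marginal of the resulting q is at most e^k times the observed one. Young's
   inequality, applied to g_m and to the density of q relative to an iterate with
   the m-th marginal right, then gives
     int q ln(q/p_M) <= (1 + e^k) (S_(N+k) - S_M) + O(N (S_(N+k) - S_N)),
   and N (S_(N+k) - S_N) is arbitrarily small for infinitely many N. So (p_M) is
   Cauchy for the Hellinger distance, and its limit f is feasible with
   KL(f||P^M) <= (1 + e^k) (lim S - S_M). Hence
   KL(f||P^0) = S_M + KL(f||P^M) tends to at most lim S <= KL(P||P^0).
   Uniqueness: if KL(P||P^0) <= lim S then KL(P||P^n) <= lim S - S_n -> 0. *)

Require Import Defs.
From HB Require Import structures.
From mathcomp Require Import all_boot all_order all_algebra.
From mathcomp Require Import all_classical all_reals all_analysis.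
From mathcomp Require Import measurable_realfun.
From mathcomp Require Import ring lra.

Set Implicit Arguments.
Unset Strict Implicit.
Unset Printing Implicit Defensive.

Import Order.TTheory GRing.Theory Num.Theory.
Import numFieldNormedType.Exports.

Local Open Scope classical_set_scope.
Local Open Scope ring_scope.
Local Open Scope charge_scope.
Local Open Scope ereal_scope.

(** * Real inequalities *)

Section real_inequalities.
Context {R : realType}.
Local Open Scope ring_scope.
Implicit Types r x y L : R.

Lemma ln_le_subr1 x : 0 < x -> ln x <= x - 1.
Proof. by move=> x0; rewrite -[in ln x](subrKC 1 x) le_ln1Dx//; lra. Qed.

(** At [x = a ^ 2] and [y = b ^ 2] this is [ln (b / a) <= b / a - 1] multiplied by [2 * a ^ 2]. At
    [x = 0] both sides equal [y], whatever the value of [ln 0]. *)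
Lemma hellinger_le_entropy x y : 0 <= x -> 0 < y ->
  (Num.sqrt x - Num.sqrt y) ^+ 2 <= x * (ln x - ln y) - x + y.
Proof.
rewrite le_eqVlt => /predU1P[<- y0|x0 y0].
  by rewrite sqrtr0 sub0r sqrrN sqr_sqrtr ?(ltW y0)// mul0r oppr0 !add0r.
have [a a0 ->] : exists2 a, 0 < a & x = a ^+ 2.
  by exists (Num.sqrt x); rewrite ?sqrtr_gt0// sqr_sqrtr// ltW.
have [b b0 ->] : exists2 b, 0 < b & y = b ^+ 2.
  by exists (Num.sqrt y); rewrite ?sqrtr_gt0// sqr_sqrtr// ltW.
rewrite !sqrtr_sqr !gtr0_norm// !lnXn//.
have := ln_le_subr1 (divr_gt0 b0 a0); rewrite ln_div ?posrE//.
move: (ln a) (ln b) => la lb h; rewrite !(mulr2n la) !(mulr2n lb).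
have : a ^+ 2 * (lb - la) <= a ^+ 2 * (b / a - 1).
  by rewrite ler_wpM2l ?sqr_ge0.
have -> : a ^+ 2 * (b / a - 1) = a * b - a ^+ 2 by field; rewrite gt_eqF.
by lra.
Qed.

(* Young's inequality for the convex conjugate pair
   [e^(-g) - 1 + g] and [(1 - s) ln (1 - s) + s <= s ^ 2], at
   [g = ln r] and [s = (x - y) / (L * y)]. *)
Lemma ln_young r x y L : 0 < r -> 0 < y -> 0 <= x -> x <= L * y -> 1 <= L ->
  ln r * (x - y) <=
  L * (y * (r^-1 - 1 + ln r)) + 4 * (Num.sqrt x - Num.sqrt y) ^+ 2.
Proof.
move=> r0 y0 x0 xy L1; have L0 : 0 < L by lra.
pose s := (x - y) / (L * y).
have Ly : 0 < L * y by exact: mulr_gt0.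
have s1 : 0 < 1 - s by rewrite subr_gt0 ltr_pdivrMr// mul1r; lra.
have z0 : 0 < r^-1 / (1 - s) by rewrite divr_gt0// invr_gt0.
have h1 := ln_le_subr1 z0.
rewrite ln_div ?posrE ?invr_gt0// lnV ?posrE// in h1.
have h2 := ln_le_subr1 s1.
have h3 : (1 - s) * (1 - ln r + s) <= r^-1.
  rewrite mulrC -ler_pdivlMr//; lra.
have h4 : ln r * s <= r^-1 - 1 + ln r + s ^+ 2 by nra.
have xs : x - y = L * y * s.
  by rewrite /s mulrC divfK// gt_eqF.
(* With [a] and [b] the two square roots, [x - y = (a - b) * (a + b)] and [(a + b) ^ 2 <= 2 * (x +
   y) <= 4 * (L * y)]; this is the origin of the factor 4. *)
have h5 : L * y * s ^+ 2 <= 4 * (Num.sqrt x - Num.sqrt y) ^+ 2.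
  have -> : L * y * s ^+ 2 = (x - y) ^+ 2 / (L * y).
    by rewrite /s; field; rewrite !gt_eqF.
  rewrite ler_pdivrMr//.
  have sx : 0 <= Num.sqrt x by rewrite sqrtr_ge0.
  have sy : 0 <= Num.sqrt y by rewrite sqrtr_ge0.
  have xE := sqr_sqrtr x0; have yE := sqr_sqrtr (ltW y0).
  set a := Num.sqrt x in sx xE *; set b := Num.sqrt y in sy yE *.
  have -> : (x - y) ^+ 2 = (a - b) ^+ 2 * (a + b) ^+ 2 by rewrite -xE -yE; ring.
  have -> : 4 * (a - b) ^+ 2 * (L * y) = (a - b) ^+ 2 * (4 * (L * y)) by ring.
  apply: ler_wpM2l; first exact: sqr_ge0.
  have : 0 <= (a - b) ^+ 2 by exact: sqr_ge0.
  have : y <= L * y by rewrite ler_peMl// ltW.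
  by lra.
have h6 : L * y * (ln r * s) <= L * y * (r^-1 - 1 + ln r + s ^+ 2).
  by rewrite ler_pM2l.
rewrite xs; move: h5 h6; nra.
Qed.

(** Factor [x - y] through the square roots and apply the AM-GM inequality with weight [t]. Leaving
    [t] free makes the integrated form do the work of Cauchy-Schwarz. *)
Lemma normB_le_sqrt x y (t : R) : 0 < t -> 0 <= x -> 0 <= y ->
  `|x - y| <= t * (x + y) + (Num.sqrt x - Num.sqrt y) ^+ 2 / t.
Proof.
move=> t0 x0 y0.
have sx : 0 <= Num.sqrt x by rewrite sqrtr_ge0.
have sy : 0 <= Num.sqrt y by rewrite sqrtr_ge0.
rewrite -{1 2}(sqr_sqrtr x0) -{1 2}(sqr_sqrtr y0).
set a := Num.sqrt x in sx *; set b := Num.sqrt y in sy *.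
rewrite subr_sqr normrM [`|a + b|]ger0_norm ?addr_ge0//.
have -> : (a - b) ^+ 2 / t = t * (`|a - b| / t) ^+ 2.
  by rewrite -[(a - b) ^+ 2]real_normK ?num_real//; field; rewrite gt_eqF.
have -> : `|a - b| * (a + b) = t * ((`|a - b| / t) * (a + b)).
  by field; rewrite gt_eqF.
rewrite -mulrDr ler_pM2l//.
move: (`|a - b| / t) => c.
have : 0 <= (c - (a + b) / 2) ^+ 2 by exact: sqr_ge0.
have : 0 <= (a - b) ^+ 2 by exact: sqr_ge0.
by nra.
Qed.

Lemma sqr_sum_le (n : nat) (a : nat -> R) :
  (\sum_(i < n) a i) ^+ 2 <= n%:R * \sum_(i < n) a i ^+ 2.
Proof.
elim: n => [|n IH]; first by rewrite !big_ord0 expr0n mulr0.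
rewrite !big_ord_recr/=.
have : \sum_(i < n) (2 * a n * a i) <= \sum_(i < n) (a i ^+ 2 + a n ^+ 2).
  by apply: ler_sum => i _; have := sqr_ge0 (a n - a i); lra.
rewrite -mulr_sumr big_split/= sumr_const card_ord -mulr_natl -natr1.
by move: IH; lra.
Qed.

Lemma xlnx_ge x : 0 <= x -> - (2 * Num.sqrt x) <= x * ln x.
Proof.
rewrite le_eqVlt => /predU1P[<-|x0]; first by rewrite sqrtr0 mulr0 oppr0 mul0r.
have [a a0 ->] : exists2 a, 0 < a & x = a ^+ 2.
  by exists (Num.sqrt x); rewrite ?sqrtr_gt0// sqr_sqrtr// ltW.
rewrite sqrtr_sqr gtr0_norm// lnXn// mulr2n.
have ai0 : 0 < a^-1 by rewrite invr_gt0.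
have := ln_le_subr1 ai0; rewrite lnV ?posrE// => h.
have : a ^+ 2 * (1 - a^-1) <= a ^+ 2 * ln a by rewrite ler_wpM2l ?sqr_ge0//; lra.
have -> : a ^+ 2 * (1 - a^-1) = a ^+ 2 - a by field; rewrite gt_eqF.
by have := sqr_ge0 a; lra.
Qed.

Lemma xlnx_le x : 0 <= x -> x * ln x <= x ^+ 2.
Proof.
rewrite le_eqVlt => /predU1P[<-|x0]; first by rewrite mul0r expr0n.
by rewrite expr2 ler_pM2l//; have := ln_le_subr1 x0; lra.
Qed.

(** At a positive limit [ln] is continuous; at 0 the product is squeezed between [xlnx_ge] and
    [xlnx_le]. This allows limits in entropy integrands whose density may vanish. *)
Lemma cvg_xlnx (u : nat -> R) (l : R) : (forall j, 0 <= u j) -> 0 <= l ->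
  u j @[j --> \oo] --> l -> u j * ln (u j) @[j --> \oo] --> l * ln l.
Proof.
move=> u0; rewrite le_eqVlt => /predU1P[<- ul|l0 ul]; last first.
  by apply: cvgM => //; apply: continuous_cvg => //; exact: continuous_ln.
rewrite mul0r.
apply: (@squeeze_cvgr _ _ _ _ (fun j => - (2 * Num.sqrt (u j)))
    (fun j => u j ^+ 2)).
- by apply: nearW => j; rewrite xlnx_ge ?xlnx_le.
- have sqrt_u : Num.sqrt (u j) @[j --> \oo] --> Num.sqrt (0 : R).
    by apply: continuous_cvg ul; exact: sqrt_continuous.
  by have := cvgN (cvgMl_tmp (a := 2) sqrt_u); rewrite sqrtr0 mulr0 oppr0; apply.
- have sqr_u : u j ^+ 2 @[j --> \oo] --> (0 : R) ^+ 2.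
    apply: (@continuous_cvg _ _ _ _ _ u (fun y => y ^+ 2) 0) ul.
    exact: exprn_continuous.
  by move: sqr_u; rewrite expr0n.
Qed.

Lemma sqrt_exp (a : R) : Num.sqrt (expR a) = expR (a / 2).
Proof.
have -> : expR a = expR (a / 2) ^+ 2 by rewrite expr2 -expRD; congr expR; lra.
by rewrite sqrtr_sqr gtr0_norm// expR_gt0.
Qed.

Lemma telescope_norm (a : nat -> R) n : `|a n - a 0| <= \sum_(j < n) `|a j.+1 - a j|.
Proof.
rewrite -(big_mkord xpredT (fun j => `|a j.+1 - a j|)) -telescope_sumr//.
exact: ler_norm_sum.
Qed.

End real_inequalities.

(** * Bounded measurable functions *)

Section bounded_measurable.
Context d (T : measurableType d) (R : realType).
Local Open Scope ring_scope.
Implicit Types f h : T -> R.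

(** Each log-ratio of the iteration is bounded, so this class, closed under all the operations in
    use, settles integrability against every probability measure. *)
Definition bmfun f := measurable_fun setT f /\ exists c, forall x, `|f x| <= c.

Lemma bmfun_cst (c : R) : bmfun (fun=> c).
Proof. by split => //; exists `|c|. Qed.

Lemma bmfunD f h : bmfun f -> bmfun h -> bmfun (fun x => f x + h x).
Proof.
move=> [mf [a fa]] [mh [b hb]]; split; first exact: measurable_funD.
by exists (a + b) => x; rewrite (le_trans (ler_normD _ _))// lerD.
Qed.

Lemma bmfunM f h : bmfun f -> bmfun h -> bmfun (fun x => f x * h x).
Proof.
move=> [mf [a fa]] [mh [b hb]]; split; first exact: measurable_funM.
by exists (a * b) => x; rewrite normrM ler_pM.
Qed.

(** A continuous [F] is bounded on the compact interval [[- a, a]] that contains the values of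
    [f]. *)
Lemma bmfun_comp (F : R -> R) f :
  continuous F -> bmfun f -> bmfun (fun x => F (f x)).
Proof.
move=> cF [mf [a fa]]; split.
  by apply: measurableT_comp mf; exact: continuous_measurable_fun.
have : compact (F @` `[- a, a]).
  apply: continuous_compact; last exact: segment_compact.
  by apply: continuous_subspaceT => x; exact: cF.
move=> /compact_bounded[M [_ FM]]; exists (M + 1) => x.
apply: FM; first by rewrite ltrDl.
by exists (f x) => //=; rewrite in_itv/= -ler_norml.
Qed.

Lemma bmfunN f : bmfun f -> bmfun (fun x => - f x).
Proof.
by move=> [mf [a fa]]; split; [exact: measurableT_comp|exists a => x; rewrite normrN].
Qed.

Lemma bmfunB f h : bmfun f -> bmfun h -> bmfun (fun x => f x - h x).
Proof. by move=> bf bh; apply: bmfunD => //; exact: bmfunN. Qed.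

Lemma bmfun_norm f : bmfun f -> bmfun (fun x => `|f x|).
Proof. by apply: bmfun_comp; exact: norm_continuous. Qed.

Lemma bmfun_exp f : bmfun f -> bmfun (fun x => expR (f x)).
Proof. by apply: bmfun_comp; exact: continuous_expR. Qed.

Lemma bmfun_sqrt f : bmfun f -> bmfun (fun x => Num.sqrt (f x)).
Proof. by apply: bmfun_comp; exact: sqrt_continuous. Qed.

Lemma bmfunX f n : bmfun f -> bmfun (fun x => f x ^+ n).
Proof. by apply: (@bmfun_comp (fun y => y ^+ n)); exact: exprn_continuous. Qed.

Lemma bmfun_sum (I : Type) (s : seq I) (f : I -> T -> R) :
  (forall i, bmfun (f i)) -> bmfun (fun x => \sum_(i <- s) f i x).
Proof.
move=> bf; elim: s => [|i s IH].
  by under eq_fun do rewrite big_nil; exact: bmfun_cst.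
by under eq_fun do rewrite big_cons; exact: bmfunD.
Qed.

Lemma bmfun_min1 f : bmfun f -> bmfun (fun x => Num.min (f x) 1).
Proof.
apply: (@bmfun_comp (fun y => Num.min y 1)) => x.
by apply: (@continuous_min _ _ id (fun=> 1)); [exact: cvg_id|exact: cvg_cst].
Qed.

End bounded_measurable.

Ltac bmauto := lazymatch goal with
  | |- bmfun (fun _ => ?c) => exact: bmfun_cst
  | |- bmfun (fun x => (@?f x + @?h x)%R) => apply: (@bmfunD _ _ _ f h); bmauto
  | |- bmfun (fun x => (- @?f x)%R) => apply: (@bmfunN _ _ _ f); bmauto
  | |- bmfun (fun x => (@?f x * @?h x)%R) => apply: (@bmfunM _ _ _ f h); bmauto
  | |- bmfun (fun x => (@?f x ^+ ?n)%R) => apply: (@bmfunX _ _ _ f n); bmauto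
  | |- bmfun (fun x => `|@?f x|%R) => apply: (@bmfun_norm _ _ _ f); bmauto
  | |- bmfun (fun x => expR (@?f x)) => apply: (@bmfun_exp _ _ _ f); bmauto
  | |- bmfun (fun x => Num.sqrt (@?f x)) => apply: (@bmfun_sqrt _ _ _ f); bmauto
  | |- bmfun (fun x => Num.min (@?f x) 1%R) => apply: (@bmfun_min1 _ _ _ f); bmauto
  | _ => first [solve [auto] | apply: bmfun_sum => ? /=; bmauto]
  end.

(** * Integrals against a probability measure *)

Section expectation.
Context d (T : measurableType d) (R : realType) (mu : probability T R).
Implicit Types (f h : T -> R) (F : nat -> T -> R).
Local Open Scope ring_scope.
Local Notation Ex := (Rintegral mu setT).

Lemma bmfun_integrable f : bmfun f -> mu.-integrable setT (EFin \o f).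
Proof.
move=> [mf [c fc]]; apply: measurable_bounded_integrable => //.
  by rewrite -ge0_fin_numE// fin_num_measure.
exists c; split; first exact: num_real.
by move=> x cx y _; apply: (le_trans (fc y)); exact: ltW.
Qed.

Lemma Rint_cst (c : R) : Ex (fun=> c) = c.
Proof. by rewrite Rintegral_cst// [X in fine X]probability_setT mulr1. Qed.

Lemma RintD f h : bmfun f -> bmfun h ->
  Ex (fun x => f x + h x) = Ex f + Ex h.
Proof. by move=> bf bh; rewrite RintegralD//; exact: bmfun_integrable. Qed.

Lemma RintB f h : bmfun f -> bmfun h ->
  Ex (fun x => f x - h x) = Ex f - Ex h.
Proof. by move=> bf bh; rewrite RintegralB//; exact: bmfun_integrable. Qed.

Lemma RintZ (c : R) f : bmfun f -> Ex (fun x => c * f x) = c * Ex f.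
Proof. by move=> bf; rewrite RintegralZl//; exact: bmfun_integrable. Qed.

Lemma Rint_sum (I : Type) (s : seq I) (f : I -> T -> R) :
  (forall i, bmfun (f i)) ->
  Ex (fun x => \sum_(i <- s) f i x) = \sum_(i <- s) Ex (f i).
Proof.
move=> bf; elim: s => [|i s IH].
  by under eq_Rintegral do rewrite big_nil; rewrite big_nil Rint_cst.
rewrite big_cons -IH -RintD//; last exact: bmfun_sum.
by apply: eq_Rintegral => x _; rewrite big_cons.
Qed.

Lemma le_Rint f h : bmfun f -> bmfun h -> (forall x, f x <= h x) -> Ex f <= Ex h.
Proof. by move=> bf bh fh; apply: le_Rintegral => //; exact: bmfun_integrable. Qed.

Lemma EFin_Rint f : mu.-integrable setT (EFin \o f) ->
  (Ex f)%:E = (\int[mu]_x (f x)%:E)%E.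
Proof. by move=> mf; rewrite /Rintegral fineK//; exact: integrable_fin_num. Qed.

(** Fatou's lemma; the lower limit of [F] agrees with the almost everywhere limit [f] outside a null
    set. *)
Lemma fatou_le F f (c : \bar R) : (forall j, measurable_fun setT (F j)) ->
  (forall j x, 0 <= F j x) -> measurable_fun setT f -> (forall x, 0 <= f x) ->
  {ae mu, forall x, F j x @[j --> \oo] --> f x} ->
  (forall j, (\int[mu]_x (F j x)%:E)%E <= c)%E -> ((\int[mu]_x (f x)%:E)%E <= c)%E.
Proof.
move=> mF F0 mf f0 Ff Fc.
have mEF j : measurable_fun setT (fun x => (F j x)%:E) by exact/measurable_EFinP.
rewrite (_ : (\int[mu]_x (f x)%:E)%E =
  (\int[mu]_x limn_einf (fun j => (F j x)%:E))%E); last first.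
  apply: ge0_ae_eq_integral => //.
  - exact/measurable_EFinP.
  - apply: (@measurableT_comp _ _ _ _ _ _ (@oppe R)) => //.
    by apply: measurable_fun_limn_esup => j; exact: measurableT_comp.
  - by move=> x _; rewrite lee_fin.
  - move=> x _; rewrite limn_einf_lim lime_ge//; first exact: is_cvg_einfs.
    by apply: nearW => n; apply: le_ereal_inf_tmp => _ [j _ <-]; rewrite lee_fin.
  - apply: filterS Ff => x Fx _.
    have : (F j x)%:E @[j --> \oo] --> (f x)%:E.
      by apply/fine_cvgP; split; [exact: nearW|exact: Fx].
    by move=> /cvg_limn_einf_sup[->].
apply: (le_trans (fatou _ _ _ _)) => //.
  by move=> n x _; rewrite lee_fin.
rewrite limn_einf_lim lime_le//; first exact: is_cvg_einfs.
by apply: nearW => n; apply: le_trans (Fc n); apply: ereal_inf_lbound; exists n => /=.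
Qed.

(** The sum [D] of the absolute increments has a finite integral, hence is finite almost everywhere,
    and there the telescoping series of [F] converges absolutely. Taking for [f] the upper limit,
    made real by [fine], gives measurability and sign everywhere. *)
Lemma cauchy_ae_cvg F (c : R) : (forall j, bmfun (F j)) ->
  (forall j x, 0 <= F j x) ->
  (forall j, Ex (fun x => `|F j.+1 x - F j x|) <= c * 2^-1 ^+ j) ->
  exists f, [/\ measurable_fun setT f, (forall x, 0 <= f x) &
    {ae mu, forall x, F j x @[j --> \oo] --> f x}].
Proof.
move=> bF F0 Fc.
pose L x := limn_esup (fun j => (F j x)%:E).
have mL : measurable_fun setT L.
  apply: measurable_fun_limn_esup => j; apply/measurable_EFinP.
  by have [] := bF j.
exists (fine \o L); split.
- exact: measurableT_comp.
- move=> x; apply: fine_ge0; rewrite /L limn_esup_lim lime_ge//.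
    exact: is_cvg_esups.
  apply: nearW => n; apply: le_trans (ereal_sup_ubound _); last by exists n => /=.
  by rewrite lee_fin.
pose G j x := `|F j.+1 x - F j x|.
have bG j : bmfun (G j) by apply: bmfun_norm; exact: bmfunB.
pose D x := (\sum_(0 <= j <oo) (G j x)%:E)%E.
have mG j : measurable_fun setT (fun x => (G j x)%:E).
  by apply/measurable_EFinP; have [] := bG j.
have D0 x : (0 <= D x)%E.
  by apply: nneseries_ge0 => n _ _; rewrite lee_fin /G.
have iD : mu.-integrable setT D.
  apply/integrableP; split.
    by apply: ge0_emeasurable_sum => // k x _ _; rewrite lee_fin /G.
  under eq_integral do rewrite gee0_abs//.
  rewrite integral_nneseries//; last by move=> n x _; rewrite lee_fin /G.
  apply: (@le_lt_trans _ _ (c * 2)%:E); last exact: ltry.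
  apply: lime_le.
    apply: is_cvg_nneseries => n _ _.
    by apply: integral_ge0 => x _; rewrite lee_fin /G.
  apply: nearW => n.
  rewrite (eq_bigr (fun j => (Ex (G j))%:E)); last first.
    by move=> j _; rewrite EFin_Rint//; exact: bmfun_integrable.
  rewrite sumEFin lee_fin (@le_trans _ _ (\sum_(0 <= j < n) c * 2^-1 ^+ j))//.
    by apply: ler_sum => j _; exact: Fc.
  have c0 : 0 <= c.
    by have := Fc 0%N; rewrite expr0 mulr1; apply: le_trans; exact: Rintegral_ge0.
  rewrite -[X in X <= _]/(series (geometric c 2^-1) n) geometric_seriesE.
    have -> : 1 - 2^-1 = 2^-1 :> R by lra.
    rewrite invrK ler_pM2r// ler_piMr// gerBl exprn_ge0//.
  by lra.
have := integrable_ae measurableT iD.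
apply: filterS => x /(_ I) Dx.
have cvgG : cvgn (series (fun j => F j.+1 x - F j x)).
  apply: normed_cvg; apply: nondecreasing_is_cvgn.
    by apply: nondecreasing_series => j _ _ /=.
  exists (fine (D x)) => _ [n _ <-]; rewrite -lee_fin fineK//.
  rewrite /series/= -sumEFin.
  by apply: nneseries_lim_ge => j _ _; rewrite lee_fin /G.
have /cvg_ex[l Fl] : cvgn (fun j => F j x).
  rewrite (_ : (fun j => F j x) =
    (fun j => F 0%N x + series (fun j => F j.+1 x - F j x) j)).
    apply: is_cvgD => //; first exact: is_cvg_cst.
  by apply/funext => j; rewrite (eq_sum_telescope (fun j => F j x)).
have : (F j x)%:E @[j --> \oo] --> l%:E.
  by apply/fine_cvgP; split; [exact: nearW|exact: Fl].
by move=> /cvg_limn_einf_sup[_ Ll]; rewrite /= /L Ll.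
Qed.

(** Entropies may be infinite, so [u] is not assumed integrable. If its integral is [+oo], the
    negative part of the sum is still dominated by the absolute value of [w], and the positive part
    must then have an infinite integral. *)
Lemma ge0_integralD_integrable (u w : T -> R) : measurable_fun setT u ->
  (forall x, 0 <= u x) -> mu.-integrable setT (EFin \o w) ->
  (\int[mu]_x (u x + w x)%:E = \int[mu]_x (u x)%:E + \int[mu]_x (w x)%:E)%E.
Proof.
move=> mu_ u0 iw; have mEu : measurable_fun setT (EFin \o u) by exact/measurable_EFinP.
have mw := measurable_int _ iw.
have [uoo|] := ltP (\int[mu]_x (u x)%:E)%E +oo%E.
  rewrite integralD_EFin//; apply/integrableP; split => //.
  by under eq_integral do rewrite gee0_abs ?lee_fin//=.
rewrite leye_eq => /eqP uoo.
have absw : (\int[mu]_x `|(w x)%:E| < +oo)%E by case/integrableP : iw.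
have wfin : (\int[mu]_x (w x)%:E)%E \is a fin_num by exact: integrable_fin_num.
rewrite uoo addye; last by rewrite -ltNye; move: wfin; rewrite fin_numE ltNye => /andP[].
pose s x := (u x + w x)%:E.
have ms : measurable_fun setT s.
  by apply/measurable_EFinP/measurable_funD => //; exact/measurable_EFinP.
have neg : (\int[mu]_x (s^\- x)%E < +oo)%E.
  apply: le_lt_trans absw; apply: ge0_le_integral => //.
  - exact: measurable_funeneg.
  - exact: measurableT_comp.
  - move=> x _; rewrite funenegE /s -EFinN -EFin_max lee_fin ge_max normr_ge0.
    by rewrite andbT opprD; have := u0 x; have := ler_norm (- w x); rewrite normrN; lra.
have pos : (\int[mu]_x (s^\+ x)%E = +oo)%E.
  apply/eqP; rewrite eq_le leey leNgt; apply/negP => pos.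
  suff : (\int[mu]_x (u x)%:E < +oo)%E by rewrite uoo ltxx.
  apply: (@le_lt_trans _ _ (\int[mu]_x (s^\+ x + `|(w x)%:E|)%E)%E).
    apply: ge0_le_integral => //.
    - by move=> x _; rewrite lee_fin.
    - apply: emeasurable_funD; first exact: measurable_funepos.
      exact: measurableT_comp.
    - move=> x _; rewrite funeposE /s -EFin_max -EFinD lee_fin.
      rewrite -lerBlDr le_max; apply/orP; left.
      by have := ler_norm (- w x); rewrite normrN; lra.
  rewrite ge0_integralD//.
  - by rewrite lte_add_pinfty.
  - exact: measurable_funepos.
  - exact: measurableT_comp.
rewrite integralE -/s pos addye// -ltNye lteNr/=.
exact: neg.
Qed.

Definition sqr_hellinger f h x := (Num.sqrt (f x) - Num.sqrt (h x)) ^+ 2.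

Lemma bmfun_sqr_hellinger f h : bmfun f -> bmfun h -> bmfun (sqr_hellinger f h).
Proof. by move=> bf bh; rewrite /sqr_hellinger; bmauto. Qed.
(** Integrate [normB_le_sqrt]: the two masses contribute at most [2 * t] and the Hellinger term at
    most [t ^ 2 / t]. *)
Lemma integral_normB_le f h (t : R) : 0 < t ->
  measurable_fun setT f -> (forall x, 0 <= f x) ->
  measurable_fun setT h -> (forall x, 0 <= h x) ->
  (\int[mu]_x (f x)%:E <= 1)%E -> (\int[mu]_x (h x)%:E <= 1)%E ->
  (\int[mu]_x (sqr_hellinger f h x)%:E <= (t ^+ 2)%:E)%E ->
  (\int[mu]_x (`|f x - h x|)%:E <= (3 * t)%:E)%E.
Proof.
move=> t0 mf f0 mh h0 f1 h1 fh.
have msqrt (u : T -> R) : measurable_fun setT u -> measurable_fun setT (fun x => Num.sqrt (u x)).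
  move=> mu_; apply: (@measurableT_comp _ _ _ _ _ _ (@Num.sqrt R)) mu_.
  by apply: continuous_measurable_fun; exact: sqrt_continuous.
have mhell : measurable_fun setT (sqr_hellinger f h).
  by apply: measurable_funX; apply: measurable_funB; exact: msqrt.
apply: (@le_trans _ _
    (\int[mu]_x (t%:E * ((f x)%:E + (h x)%:E) + (t^-1)%:E * (sqr_hellinger f h x)%:E))%E).
  apply: ge0_le_integral => //.
  - apply/measurable_EFinP; apply: measurableT_comp => //.
    exact: measurable_funB.
  - apply: emeasurable_funD; apply: emeasurable_funM => //.
      by apply: emeasurable_funD; exact/measurable_EFinP.
    exact/measurable_EFinP.
  - move=> x _.
    rewrite -[leRHS]/((t * (f x + h x) + t^-1 * sqr_hellinger f h x)%R%:E) lee_fin.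
    by rewrite [X in (_ <= _ + X)%R]mulrC; exact: normB_le_sqrt.
have mE (u : T -> R) : measurable_fun setT u -> measurable_fun setT (fun x => (u x)%:E).
  by move=> mu_; exact/measurable_EFinP.
have hell0 x : (0 <= sqr_hellinger f h x)%R by exact: sqr_ge0.
have t'0 : (0 <= t^-1)%R by rewrite invr_ge0 ltW.
rewrite ge0_integralD//; last first.
- by apply: emeasurable_funM => //; exact: mE.
- by move=> x _; rewrite mule_ge0 ?lee_fin.
- by apply: emeasurable_funM => //; apply: emeasurable_funD; exact: mE.
- by move=> x _; rewrite mule_ge0 ?adde_ge0 ?lee_fin// ltW.
rewrite ge0_integralZl ?lee_fin ?(ltW t0)//; last first.
- by move=> x _; rewrite adde_ge0 ?lee_fin.
- by apply: emeasurable_funD; exact: mE.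
rewrite ge0_integralZl ?lee_fin//; last 2 first.
- exact: mE.
- by move=> x _; rewrite lee_fin.
rewrite ge0_integralD//; last first.
- exact: mE.
- by move=> x _; rewrite lee_fin.
- exact: mE.
- by move=> x _; rewrite lee_fin.
apply: (@le_trans _ _ (t%:E * (1 + 1) + (t^-1)%:E * (t ^+ 2)%:E)%E).
  by rewrite leeD// lee_wpmul2l ?lee_fin ?(ltW t0)// leeD.
rewrite -[leLHS]/((t * (1 + 1) + t^-1 * t ^+ 2)%R%:E) lee_fin le_eqVlt; apply/orP; left; apply/eqP.
by field; rewrite gt_eqF.
Qed.

Lemma Rint_normB_le f h t : 0 < t -> bmfun f -> bmfun h ->
  (forall x, 0 <= f x) -> (forall x, 0 <= h x) -> Ex f <= 1 -> Ex h <= 1 ->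
  Ex (sqr_hellinger f h) <= t ^+ 2 -> Ex (fun x => `|f x - h x|) <= 3 * t.
Proof.
move=> t0 bf bh f0 h0 f1 h1 fh; have [mf _] := bf; have [mh _] := bh.
have bfh : bmfun (sqr_hellinger f h) by exact: bmfun_sqr_hellinger.
have bnorm : bmfun (fun x => `|f x - h x|) by bmauto.
rewrite -lee_fin EFin_Rint; last exact: bmfun_integrable.
by apply: integral_normB_le => //; rewrite -EFin_Rint ?lee_fin//; exact: bmfun_integrable.
Qed.

Lemma Rint_triangle f h l : bmfun f -> bmfun h -> bmfun l ->
  Ex (fun x => `|f x - h x|) <= Ex (fun x => `|f x - l x|) + Ex (fun x => `|h x - l x|).
Proof.
move=> bf bh bl; rewrite -RintD; [|by bmauto..].
apply: le_Rint => [||x]; [by bmauto..|].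
by rewrite [X in _ <= _ + X]distrC (le_trans _ (ler_normD _ _))// addrA subrK.
Qed.

Lemma integrable_bmfunM h f : bmfun h -> mu.-integrable setT (EFin \o f) ->
  mu.-integrable setT (EFin \o (fun x => h x * f x)).
Proof.
move=> [mh [c hc]] intf; apply: (@integrableMr _ _ _ _ _ _ h (EFin \o f)) => //.
exists c; split; first exact: num_real.
by move=> y cy x _; apply: (le_trans (hc x)); exact: ltW.
Qed.

End expectation.

(** * Iterated scaling *)

Section iterated_scaling.
Context d (T : measurableType d) (R : realType) (mu : probability T R).
Variables (k : nat) (g : nat -> T -> R).
Local Open Scope ring_scope.
Local Notation Ex := (Rintegral mu setT).

Definition scaling_density n x := expR (\sum_(m < n) g m x).
Local Notation p := scaling_density.

Hypothesis k_gt0 : (0 < k)%N.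
Hypothesis bg : forall m, bmfun (g m).
Hypothesis Ex_scaling_density1 : forall n, Ex (p n) = 1.
(** This is all that is kept of the observed marginals: [g m] is a function of the map used at step
    [m], so its law is the same under all iterates that have just been updated through that map. *)
Hypothesis Ex_cycle : forall m n (F : R -> R), m = n %[mod k] -> continuous F ->
  Ex (fun x => F (g m x) * p n.+1 x) = Ex (fun x => F (g m x) * p m.+1 x).

(** Since [g m] is the logarithm of the ratio of [p m.+1] to [p m], this is the divergence of
    iterate [m.+1] from iterate [m]. *)
Definition scaling_gain m := Ex (fun x => g m x * p m.+1 x).
Local Notation eps := scaling_gain.

Definition total_gain n := \sum_(m < n) eps m.
Local Notation S := total_gain.

(* Capping the last ratios keeps each marginal of [capped_density N k] below
   [expR k] times the observed one, however large these ratios are. *)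
Definition capped_density N j x :=
  expR (\sum_(m < N) g m x + \sum_(i < j) Num.min (g (N + i)%N x) 1).
Local Notation q := capped_density.

Lemma bmfun_scaling_density n : bmfun (p n).
Proof. by rewrite /p; bmauto. Qed.
Hint Resolve bmfun_scaling_density : core.

Lemma bmfun_capped_density N j : bmfun (q N j).
Proof. by rewrite /q; bmauto. Qed.
Hint Resolve bmfun_capped_density : core.

Lemma scaling_density_gt0 n x : 0 < p n x. Proof. exact: expR_gt0. Qed.
Lemma capped_density_gt0 n j x : 0 < q n j x. Proof. exact: expR_gt0. Qed.
Hint Resolve scaling_density_gt0 capped_density_gt0 : core.

Lemma scaling_densityS n x : p n.+1 x = p n x * expR (g n x).
Proof. by rewrite /p big_ord_recr expRD. Qed.

Lemma ln_scaling_density n x : ln (p n x) = \sum_(m < n) g m x.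
Proof. by rewrite expRK. Qed.

(** The added part of the integrand is [p m x - p m.+1 x], of integral 0. The resulting integrand is
    the nonnegative one that occurs in [ln_young]. *)
Lemma scaling_gainE m : Ex (fun x => (expR (- g m x) - 1 + g m x) * p m.+1 x) = eps m.
Proof.
have -> : (fun x => (expR (- g m x) - 1 + g m x) * p m.+1 x) =
    (fun x => (p m x - p m.+1 x) + g m x * p m.+1 x).
  apply/funext => x; rewrite mulrDl mulrBl mul1r; congr (_ - _ + _).
  by rewrite scaling_densityS mulrCA -expRD addNr expR0 mulr1.
rewrite RintD; [|by bmauto..].
by rewrite RintB; [|by bmauto..]; rewrite !Ex_scaling_density1 subrr add0r.
Qed.

Hint Resolve bmfun_sqr_hellinger : core.

Lemma sqr_hellinger_step m : Ex (sqr_hellinger (p m.+1) (p m)) <= eps m.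
Proof.
have -> : eps m = Ex (fun x => g m x * p m.+1 x - p m.+1 x + p m x).
  rewrite RintD; [|by bmauto..].
  by rewrite RintB; [|by bmauto..]; rewrite !Ex_scaling_density1 subrK.
apply: le_Rint => [||x]; [by bmauto..|].
apply: (le_trans (hellinger_le_entropy _ _)); [exact: ltW|by []|].
by rewrite !ln_scaling_density big_ord_recr/= [_ + g m x]addrC addrK mulrC.
Qed.

Lemma scaling_gain_ge0 m : 0 <= eps m.
Proof. by apply: le_trans (sqr_hellinger_step m); apply: Rintegral_ge0 => x _; exact: sqr_ge0. Qed.

Lemma le_total_gain : {homo S : m n / (m <= n)%N >-> m <= n}.
Proof.
apply/nondecreasing_seqP => n; rewrite /S big_ord_recr/= lerDl; exact: scaling_gain_ge0.
Qed.

Lemma total_gainB m n : (m <= n)%N -> S n - S m = \sum_(m <= j < n) eps j.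
Proof.
move=> mn; rewrite /S -!(big_mkord xpredT eps) (big_cat_nat (n := m))//=.
by rewrite addrAC subrr add0r.
Qed.

(** The first [i] capped factors are at most the uncapped ones, and each of the other [j - i] is at
    most [expR 1]. *)
Lemma ln_capped_density_le N j i x : (i <= j)%N ->
  ln (q N j x) <= ln (p (N + i) x) + (j - i)%:R.
Proof.
move=> ij; rewrite ln_scaling_density /q expRK big_split_ord/= -addrA lerD2l.
rewrite -(big_mkord xpredT (fun i => Num.min (g (N + i)%N x) 1)).
rewrite (big_cat_nat (n := i))//= big_mkord lerD//.
  by apply: ler_sum => l _; rewrite ge_min lexx.
rewrite -[leRHS]mul1r mulr_natr -sumr_const_nat; apply: ler_sum => l _.
by rewrite ge_min lexx orbT.
Qed.

(** Supplies the hypothesis [x <= L * y] of [ln_young] for every iterate of the window at once, with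
    [L = expR k]. *)
Lemma capped_density_le N j i x : (i <= j <= k)%N -> q N j x <= expR k%:R * p (N + i) x.
Proof.
move=> /andP[ij jk]; rewrite -ler_ln ?posrE ?mulr_gt0 ?expR_gt0//.
rewrite lnM ?posrE ?expR_gt0// expRK addrC (le_trans (ln_capped_density_le N x ij))//.
by rewrite lerD2l ler_nat (leq_trans _ jk)// leq_subr.
Qed.

Definition sqr_hellinger_sum N x := \sum_(j < k) sqr_hellinger (p (N + j).+1) (p (N + j)) x.

Lemma Ex_sqr_hellinger_sum N : Ex (sqr_hellinger_sum N) <= S (N + k) - S N.
Proof.
rewrite total_gainB ?leq_addr// Rint_sum => [|i]; last by bmauto.
rewrite -[in leRHS](add0n N) big_addn addKn big_mkord.
by apply: ler_sum => j _; rewrite addnC; exact: sqr_hellinger_step.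
Qed.

(** Go from [q N k] to [p (N + i)] through [p N], telescoping the square roots along both paths. A
    capped step is no longer than the uncapped one: [q N j] is at most [p (N + j)], and capping
    moves a factor above [expR 1] closer to 1. The constant is the square of 2, for the two paths,
    times the [k] of [sqr_sum_le]. *)
Lemma sqr_hellinger_capped_le N i x : (i <= k)%N ->
  sqr_hellinger (q N k) (p (N + i)) x <= 4 * k%:R * sqr_hellinger_sum N x.
Proof.
move=> ik; pose dd j : R := `|Num.sqrt (p (N + j).+1 x) - Num.sqrt (p (N + j) x)|.
have hp : `|Num.sqrt (p (N + i) x) - Num.sqrt (p N x)| <= \sum_(j < k) dd j.
  have := telescope_norm (fun j => Num.sqrt (p (N + j) x)) i; rewrite addn0.
  move=> /le_trans; apply; rewrite -(big_mkord xpredT dd) (big_cat_nat (n := i))//=.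
  rewrite big_mkord -[leLHS]addr0; apply: lerD; last by apply: sumr_ge0 => j _; exact: normr_ge0.
  by apply: ler_sum => j _; rewrite /dd addnS.
have hq : `|Num.sqrt (q N k x) - Num.sqrt (p N x)| <= \sum_(j < k) dd j.
  have := telescope_norm (fun j => Num.sqrt (q N j x)) k.
  rewrite {2}/q big_ord0 addr0 => /le_trans; apply; apply: ler_sum => j _.
  have qS : q N j.+1 x = q N j x * expR (Num.min (g (N + j)%N x) 1).
    by rewrite /q big_ord_recr/= addrA expRD.
  have normM (a b : R) : 0 <= a ->
      `|Num.sqrt (a * b) - Num.sqrt a| = Num.sqrt a * `|Num.sqrt b - 1|.
    move=> a0; rewrite sqrtrM// -[X in _ - X]mulr1 -mulrBr normrM.
    by rewrite ger0_norm// sqrtr_ge0.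
  rewrite /dd qS scaling_densityS !normM ?expR_ge0//; apply: ler_pM => //.
    apply: ler_wsqrtr; rewrite -ler_ln ?posrE//.
    by have := ln_capped_density_le N x (leqnn j); rewrite subnn addr0.
  rewrite !sqrt_exp; have [g1|g1] := leP (g (N + j)%N x) 1; first by [].
  have e1 (a : R) : 1 <= a -> 0 <= expR (a / 2) - 1.
    by move=> a1; rewrite subr_ge0 -[X in X <= _]expR0 ler_expR; lra.
  by rewrite !ger0_norm ?e1 ?(ltW g1)// lerD2r ler_expR; lra.
have -> : sqr_hellinger (q N k) (p (N + i)) x =
    `|(Num.sqrt (q N k x) - Num.sqrt (p N x)) -
      (Num.sqrt (p (N + i) x) - Num.sqrt (p N x))| ^+ 2.
  by rewrite real_normK ?num_real// /sqr_hellinger; congr (_ ^+ 2); ring.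
apply: (@le_trans _ _ ((2 * \sum_(j < k) dd j) ^+ 2)).
  have dd0 : 0 <= \sum_(j < k) dd j by apply: sumr_ge0 => j _; exact: normr_ge0.
  rewrite ler_sqr ?nnegrE ?mulr_ge0//.
  by rewrite (le_trans (ler_normB _ _))// mulr2n mulrDl mul1r lerD.
rewrite exprMn -mulrA (_ : 2 ^+ 2 = 4); last by ring.
rewrite ler_pM2l// (le_trans (sqr_sum_le _ _))// ler_pM2l ?ltr0n//.
by apply: ler_sum => j _; rewrite /dd real_normK ?num_real.
Qed.


(** * Entropy and mass of the capped densities *)

Local Notation L := (@expR R k%:R).
Local Notation Q N := (q N k).

Lemma expR_nat_ge1 : 1 <= L.
Proof. by rewrite -[X in X <= _]expR0 ler_expR ler0n. Qed.

Lemma Ex_sqr_hellinger_window N i : (i <= k)%N ->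
  Ex (sqr_hellinger (Q N) (p (N + i))) <= 4 * k%:R * (S (N + k) - S N).
Proof.
move=> ik; have bh : bmfun (sqr_hellinger_sum N) by rewrite /sqr_hellinger_sum; bmauto.
apply: (@le_trans _ _ (Ex (fun x => 4 * k%:R * sqr_hellinger_sum N x))).
  by apply: le_Rint => [||x]; [by bmauto..|exact: sqr_hellinger_capped_le].
by rewrite RintZ// ler_wpM2l ?mulr_ge0// Ex_sqr_hellinger_sum.
Qed.

Lemma cycle_index m N : exists2 i, (i < k)%N & m = (N + i)%N %[mod k].
Proof.
(* [N * k.-1] stands for [- N] modulo [k]. *)
exists ((m + N * k.-1) %% k)%N; first by rewrite ltn_mod.
by rewrite modnDmr addnCA -mulnS prednK// addnC modnMDl.
Qed.

(** Apply [ln_young] with [r = expR (g m x)] and [y] the iterate of the window that has just been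
    updated through the map of step [m]. Against that iterate, [g m] and [expR (- g m) - 1 + g m]
    both integrate to [eps m], which gives [1 + L]; the 16 is the 4 of [ln_young] times the 4 of
    [Ex_sqr_hellinger_window]. *)
Lemma Ex_capped_gain_le m N : Ex (fun x => g m x * Q N x) <=
  (1 + L) * eps m + 16 * k%:R * (S (N + k) - S N).
Proof.
have [i ik mi] := cycle_index m N; rewrite -/(Q N).
pose p' := p (N + i).+1.
have bp' : bmfun p' := bmfun_scaling_density _.
have eE : eps m = Ex (fun x => g m x * p' x).
  by rewrite (@Ex_cycle m (N + i)%N id mi)// => y; exact: cvg_id.
have eE' : eps m = Ex (fun x => (expR (- g m x) - 1 + g m x) * p' x).
  rewrite (@Ex_cycle m (N + i)%N (fun y => expR (- y) - 1 + y) mi) ?scaling_gainE// => y.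
  apply: cvgD; last exact: cvg_id.
  apply: cvgB; last exact: cvg_cst.
  by apply: (@continuous_comp _ _ _ -%R expR); [exact: opp_continuous|exact: continuous_expR].
apply: (@le_trans _ _ (Ex (fun x => g m x * p' x +
    L * ((expR (- g m x) - 1 + g m x) * p' x) + 4 * sqr_hellinger (Q N) p' x))).
  apply: le_Rint => [||x]; [by bmauto..|].
  have := @ln_young _ (expR (g m x)) (Q N x) (p' x) L (expR_gt0 _) (scaling_density_gt0 _ _).
  rewrite expRK -expRN => /(_ (ltW (capped_density_gt0 _ _ _)) _ expR_nat_ge1).
  rewrite /p' -addnS capped_density_le ?ik ?leqnn// => /(_ isT).
  rewrite /sqr_hellinger; lra.
rewrite RintD; [|by bmauto..]; rewrite RintD; [|by bmauto..].
rewrite !RintZ; [|by bmauto..]; rewrite -eE -eE'.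
have := Ex_sqr_hellinger_window N ik; rewrite addnS -/p'; lra.
Qed.

Lemma ln_capped_density_le_scaling N x : ln (Q N x) <= ln (p (N + k) x).
Proof. by have := ln_capped_density_le N x (leqnn k); rewrite subnn addr0. Qed.

Lemma capped_density_le_scaling N x : Q N x <= p (N + k) x.
Proof. by rewrite -ler_ln ?posrE// ln_capped_density_le_scaling. Qed.

Lemma bmfun_ln_scaling_density n : bmfun (fun x => ln (p n x)).
Proof. by under eq_fun do rewrite ln_scaling_density; bmauto. Qed.

Lemma bmfun_ln_capped_density N j : bmfun (fun x => ln (q N j x)).
Proof. by under eq_fun do rewrite /q expRK; bmauto. Qed.
Hint Resolve bmfun_ln_scaling_density bmfun_ln_capped_density : core.

(** As [Q N] lies below [p (N + k)], its log-ratio to [p M] is at most the sum of the [g m] with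
    [M <= m < N + k], and [Ex_capped_gain_le] bounds the integral of each of them against [Q N]. *)
Lemma Ex_capped_entropy_le M N : (M <= N)%N ->
  Ex (fun x => Q N x * (ln (Q N x) - ln (p M x))) <=
  (1 + L) * (S (N + k) - S M) + (N + k)%:R * (16 * k%:R * (S (N + k) - S N)).
Proof.
move=> MN; have MNk : (M <= N + k)%N by rewrite (leq_trans MN) ?leq_addr.
apply: (@le_trans _ _ (Ex (fun x => \sum_(M <= m < N + k) g m x * Q N x))).
  apply: le_Rint => [||x]; [by bmauto..|].
  rewrite -mulr_suml mulrC ler_wpM2r//; first exact: ltW.
  rewrite lerBlDr (le_trans (ln_capped_density_le_scaling _ _))//.
  rewrite !ln_scaling_density -!(big_mkord xpredT (g ^~ x)).
  by rewrite (big_cat_nat (n := M))//= addrC.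
rewrite Rint_sum => [|m]; last by bmauto.
apply: (le_trans (ler_sum _ (fun m _ => Ex_capped_gain_le m N))).
rewrite big_split/= -mulr_sumr -total_gainB// lerD2l sumr_const_nat -[leLHS]mulr_natl.
rewrite ler_wpM2r ?ler_nat ?leq_subr// mulr_ge0 ?mulr_ge0// subr_ge0 le_total_gain//.
exact: leq_addr.
Qed.

Lemma Ex_capped_density_le1 N : Ex (Q N) <= 1.
Proof.
rewrite -(Ex_scaling_density1 (N + k)).
by apply: le_Rint => // x; exact: capped_density_le_scaling.
Qed.

(** Capping loses little mass, since [Q N] is Hellinger-close to [p (N + k)], whose mass is 1; [t]
    is left free to balance the two terms. *)
Lemma Ex_capped_density_ge N t : 0 < t ->
  1 - Ex (Q N) <= 2 * t + 4 * k%:R * (S (N + k) - S N) / t.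
Proof.
move=> t0; rewrite -(Ex_scaling_density1 (N + k)) -RintB//.
apply: (@le_trans _ _
    (Ex (fun x => t * (Q N x + p (N + k) x) + t^-1 * sqr_hellinger (Q N) (p (N + k)) x))).
  apply: le_Rint => [||x]; [by bmauto..|].
  rewrite (le_trans (ler_norm _))// distrC.
  apply: le_trans (normB_le_sqrt t0 (ltW (capped_density_gt0 _ _ _))
    (ltW (scaling_density_gt0 _ _))) _.
  by rewrite [X in _ + X]mulrC.
rewrite RintD; [|by bmauto..]; rewrite !RintZ; [|by bmauto..].
rewrite RintD; [|by bmauto..]; rewrite Ex_scaling_density1 lerD//.
  by rewrite mulrC ler_pM2r//; have := Ex_capped_density_le1 N; lra.
by rewrite mulrC ler_pM2r ?invr_gt0// Ex_sqr_hellinger_window.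
Qed.


(** * Bounded total gain and windows of small error *)

Hypothesis S_bounded : exists B, forall n, S n <= B.

Local Notation Slim := (limn S).

Lemma is_cvg_total_gain : cvgn S.
Proof.
have [B S_le] := S_bounded; apply: nondecreasing_is_cvgn => //; first exact: le_total_gain.
by exists B => _ [n _ <-].
Qed.

Lemma total_gain_le_lim n : S n <= Slim.
Proof. by apply: nondecreasing_cvgn_le; [exact: le_total_gain|exact: is_cvg_total_gain]. Qed.

(** The error term of [Ex_capped_entropy_le], plus the mass that [Q N] lacks to be a probability
    density. *)
Definition window_error N :=
  (N + k)%:R * (16 * k%:R * (S (N + k) - S N)) + (1 - Ex (Q N)).
Local Notation err := window_error.

Lemma total_gainB_ge0 m n : (m <= n)%N -> 0 <= S n - S m.
Proof. by move=> mn; rewrite subr_ge0 le_total_gain. Qed.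

(** The terms [- f x + p M x] integrate to 0 for a probability density [f] and make the integrand
    nonnegative pointwise, so that Fatou's lemma applies and the integral makes sense even when
    infinite. *)
Definition kl_integrand (f : T -> R) M x :=
  f x * (ln (f x) - ln (p M x)) - f x + p M x.

Lemma Ex_kl_capped_le M N : (M <= N)%N ->
  Ex (kl_integrand (Q N) M) <= (1 + L) * (Slim - S M) + err N.
Proof.
move=> MN; rewrite /kl_integrand RintD; [|by bmauto..].
rewrite RintB; [|by bmauto..]; rewrite Ex_scaling_density1.
have := Ex_capped_entropy_le MN; rewrite /err.
have : (1 + L) * (S (N + k) - S M) <= (1 + L) * (Slim - S M).
  by rewrite ler_wpM2l ?lerD2r ?total_gain_le_lim.
lra.
Qed.

Lemma Ex_sqr_hellinger_capped_le M N : (M <= N)%N ->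
  Ex (sqr_hellinger (Q N) (p M)) <= (1 + L) * (Slim - S M) + err N.
Proof.
move=> MN; apply: le_trans (Ex_kl_capped_le MN); rewrite /kl_integrand.
apply: le_Rint => [||x]; [by bmauto..|].
by apply: hellinger_le_entropy => //; exact: ltW.
Qed.

Lemma tail_lt eta : 0 < eta -> exists n0, forall n, (n0 <= n)%N ->
  (1 + L) * (Slim - S n) < eta.
Proof.
move=> eta0; have L0 : 0 < 1 + L by have := expR_nat_ge1; lra.
have /cvgrPdist_lt/(_ (eta / (1 + L)))[|n0 _ n0P] := is_cvg_total_gain.
  exact: divr_gt0.
exists n0 => n /n0P/=; rewrite ger0_norm ?subr_ge0 ?total_gain_le_lim//.
by rewrite ltr_pdivlMr// mulrC.
Qed.

(* Along [N = N0 + j * k], [j < N0], the increments of [S] telescope to at most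
   the tail of [S] at [N0], so one of them is at most [1 / N0] times this tail,
   whereas [N + k <= N0 * k.+1]. *)
Lemma exists_small_increment eta n0 : 0 < eta ->
  exists2 N, (n0 <= N)%N & (N + k)%:R * (S (N + k) - S N) <= eta.
Proof.
move=> eta0; have k1 : 0 < k.+1%:R :> R by rewrite ltr0n.
have /cvgrPdist_lt/(_ (eta / k.+1%:R) (divr_gt0 eta0 k1))[n1 _ n1P] := is_cvg_total_gain.
pose N0 := maxn (maxn n0 n1) 1.
have N0_gt0 : 0 < N0%:R :> R by rewrite ltr0n leq_max orbT.
apply: contrapT => /forall2NP noN.
have big (j : 'I_N0) :
    eta / k.+1%:R / N0%:R < S (N0 + j.+1 * k) - S (N0 + j * k).
  have := noN (N0 + j * k)%N; case.
    by rewrite (leq_trans _ (leq_addr _ _))// !leq_max leqnn.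
  move=> /negP; rewrite -ltNge -addnA -mulSnr => big.
  rewrite -mulrA -invfM ltr_pdivrMr ?mulr_gt0// (lt_le_trans big)// mulrC.
  rewrite ler_wpM2l ?total_gainB_ge0// ?leq_add2l ?leq_mul2r ?leqnSn ?orbT//.
  by rewrite -natrM ler_nat [leqRHS]mulnC mulnS leq_add2l leq_mul2r ltn_ord orbT.
have : \sum_(j < N0) (eta / k.+1%:R / N0%:R) <=
    \sum_(j < N0) (S (N0 + j.+1 * k) - S (N0 + j * k)).
  by apply: ler_sum => j _; exact/ltW.
rewrite -(big_mkord xpredT (fun j => S (N0 + j.+1 * k) - S (N0 + j * k))).
rewrite (telescope_sumr (fun j => S (N0 + j * k)))//.
rewrite sumr_const card_ord -[leLHS]mulr_natr divfK ?gt_eqF// mul0n addn0.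
have := n1P N0; rewrite /= ger0_norm ?subr_ge0 ?total_gain_le_lim// => /(_ _)H1.
have := H1 (leq_trans (leq_maxr n0 n1) (leq_maxl _ _)).
move=> lim_lt le_sum; have le_lim := total_gain_le_lim (N0 + N0 * k).
by have := le_lt_trans (le_trans le_sum (lerD le_lim (lexx _))) lim_lt; rewrite ltxx.
Qed.

Lemma exists_small_error eta n0 : 0 < eta ->
  exists2 N, (n0 <= N)%N & err N <= eta.
Proof.
move=> eta0; have k0 : 1 <= k%:R :> R by rewrite ler1n.
have k0' : 0 < k%:R :> R by rewrite ltr0n.
(* The target is [eta / 2 + eta / 4 + eta / 4]. The first entry of the minimum makes [16 * k * e] at
   most [eta / 2]; the second makes [4 * k * e / t] at most [eta / 4] for [t = eta / 8], where also
   [2 * t = eta / 4]. *)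
pose e := Num.min (eta / (32 * k%:R)) (eta ^+ 2 / (128 * k%:R)).
have e0 : 0 < e by rewrite lt_min !divr_gt0 ?mulr_gt0 ?exprn_gt0.
have [N n0N NP] := exists_small_increment n0 e0; exists N => //.
have SN : S (N + k) - S N <= e.
  apply: le_trans NP; rewrite ler_peMl ?total_gainB_ge0 ?leq_addr// natrD.
  by have : 0 <= N%:R :> R := ler0n _ _; lra.
have t0 : 0 < eta / 8 by lra.
have := Ex_capped_density_ge N t0; rewrite /err => h1.
have h2 : 4 * k%:R * (S (N + k) - S N) / (eta / 8) <= eta / 4.
  rewrite ler_pdivrMr// (@le_trans _ _ (4 * k%:R * (eta ^+ 2 / (128 * k%:R))))//.
    rewrite ler_wpM2l ?mulr_ge0 ?ler0n// (le_trans SN)//.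
    by rewrite ge_min lexx orbT.
  suff -> : 4 * k%:R * (eta ^+ 2 / (128 * k%:R)) = eta / 4 * (eta / 8) by [].
  by field; rewrite gt_eqF.
have h3 : (N + k)%:R * (16 * k%:R * (S (N + k) - S N)) <= eta / 2.
  rewrite mulrCA (@le_trans _ _ (16 * k%:R * (eta / (32 * k%:R))))//.
    rewrite ler_wpM2l ?mulr_ge0 ?ler0n// (le_trans NP)//.
    by rewrite ge_min lexx.
  suff -> : 16 * k%:R * (eta / (32 * k%:R)) = eta / 2 by [].
  by field; rewrite gt_eqF.
lra.
Qed.


(** * Construction of the limit density *)

Lemma Ex_normB_capped_le M N t : (M <= N)%N -> 0 < t ->
  (1 + L) * (Slim - S M) + err N <= t ^+ 2 ->
  Ex (fun x => `|Q N x - p M x|) <= 3 * t.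
Proof.
move=> MN t0 h; apply: Rint_normB_le => //.
- by move=> x; exact: ltW.
- by move=> x; exact: ltW.
- exact: Ex_capped_density_le1.
- by rewrite Ex_scaling_density1.
- exact: le_trans (Ex_sqr_hellinger_capped_le MN) h.
Qed.

(** The powers of [4^-1] bound squared Hellinger distances; their square roots give the geometric
    rate that [cauchy_ae_cvg] asks for. *)
Lemma good_windows : exists w : nat -> nat, forall j,
  [/\ (j <= w j)%N, err (w j) <= 4^-1 ^+ j & (1 + L) * (Slim - S (w j)) <= 4^-1 ^+ j].
Proof.
suff /boolp.choice : forall j, exists N, [/\ (j <= N)%N, err N <= 4^-1 ^+ j &
    (1 + L) * (Slim - S N) <= 4^-1 ^+ j] by case=> w wP; exists w.
move=> j; have e0 : 0 < 4^-1 ^+ j :> R by rewrite exprn_gt0// invr_gt0.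
have [n0 n0P] := tail_lt e0.
have [N n0N NP] := exists_small_error (maxn j n0) e0.
move: n0N; rewrite geq_max => /andP[jN n0N].
by exists N; split => //; exact/ltW/n0P.
Qed.

Lemma measurable_ln_scaling_density n : measurable_fun setT (fun x => ln (p n x)).
Proof. by have [] := bmfun_ln_scaling_density n. Qed.

Lemma kl_integrand_ge0 f n x : (forall x, 0 <= f x) -> 0 <= kl_integrand f n x.
Proof.
move=> f0; apply: le_trans (hellinger_le_entropy (f0 x) (scaling_density_gt0 n x)).
exact: sqr_ge0.
Qed.

Lemma measurable_kl_integrand f n : measurable_fun setT f ->
  measurable_fun setT (kl_integrand f n).
Proof.
move=> mf; have [mp _] := bmfun_scaling_density n.
apply: measurable_funD => //; apply: measurable_funB => //; apply: measurable_funM => //.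
apply: measurable_funB; last exact: measurable_ln_scaling_density.
by apply: (@measurableT_comp _ _ _ _ _ _ (@ln R)) mf.
Qed.

(** [f] is the almost everywhere limit of the capped densities of the good windows. Fatou's lemma
    transfers to it their distance to [p n] and their divergence from [p M]. Every [n] precedes all
    late enough windows, so the whole sequence of the [p n] converges and not only a subsequence. *)
Lemma scaling_limit : exists f : T -> R,
  [/\ measurable_fun setT f, (forall x, 0 <= f x),
      (forall e : R, 0 < e -> exists n0, forall n, (n0 <= n)%N ->
        (\int[mu]_x (`|p n x - f x|)%:E <= e%:E)%E) &
      (forall M, (\int[mu]_x (kl_integrand f M x)%:E <=
        ((1 + L) * (Slim - S M))%:E)%E)].
Proof.
have [w wP] := good_windows.
have pow0 e : 0 < e -> exists j0, forall j, (j0 <= j)%N -> 4^-1 ^+ j < e :> R.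
  move=> e0; have : `|4^-1| < 1 :> R by rewrite ger0_norm ?invr_ge0//; lra.
  move=> /(@cvg_geometric R 1)/cvgrPdist_lt/(_ _ e0)[j0 _ j0P].
  exists j0 => j /j0P; rewrite /= mul1r sub0r normrN; apply: le_lt_trans.
  exact: ler_norm.
have [|j x|j|f [mf f0 Qf]] := @cauchy_ae_cvg _ _ _ mu (fun j => Q (w j)) 12.
- by [].
- exact: ltW.
- have [jw ej tj] := wP j; have [jw1 ej1 tj1] := wP j.+1.
  (* [w] need not be monotone, so both neighbours are compared with the earlier iterate [p M]. Each
     squared Hellinger distance is at most [2 * 4^-1 ^+ j], hence at most [t ^ 2], and the two L1
     distances add up to [6 * t], that is [12 * 2^-1 ^+ j]. *)
  pose t : R := 2 * 2^-1 ^+ j; pose M := minn (w j) (w j.+1).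
  have q0 : 0 < 4^-1 ^+ j :> R by rewrite exprn_gt0// invr_gt0.
  have q1 : 4^-1 ^+ j.+1 <= 4^-1 ^+ j :> R.
    by rewrite exprS; lra.
  have tM : (1 + L) * (Slim - S M) <= 4^-1 ^+ j.
    by rewrite /M; case: leqP => // _; exact: le_trans q1.
  have t0 : 0 < t by rewrite mulr_gt0// exprn_gt0// invr_gt0.
  have t2 : t ^+ 2 = 4 * 4^-1 ^+ j.
    rewrite /t exprMn -exprM mulnC exprM (_ : 2 ^+ 2 = 4); last by ring.
    by congr (_ * _ ^+ _); field.
  have h1 : Ex (fun x => `|Q (w j.+1) x - p M x|) <= 3 * t.
    by apply: Ex_normB_capped_le => //; [exact: geq_minr|lra].
  have h2 : Ex (fun x => `|Q (w j) x - p M x|) <= 3 * t.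
    by apply: Ex_normB_capped_le => //; [exact: geq_minl|lra].
  apply: (le_trans (Rint_triangle mu (l := p M) _ _ _)) => //.
  by rewrite /t in h1 h2 *; lra.
exists f; split => //.
- move=> e e0; pose t := e / 3; have t0 : 0 < t by exact: divr_gt0.
  (* One half of [t ^ 2] is for the tail of [S], the other for the window error. *)
  have t2 : 0 < t ^+ 2 / 2 by rewrite divr_gt0// exprn_gt0.
  have [n0 n0P] := tail_lt t2; have [j0 j0P] := pow0 _ t2.
  exists n0 => n n0n.
  (* Dropping the first [j0 + n] windows leaves those that start after [n] and have a window error
     below [t ^ 2 / 2]. *)
  apply: (@fatou_le _ _ _ mu (fun j x => `|p n x - Q (w (j + (j0 + n))%N) x|)).
  + move=> j; have : bmfun (fun x => `|p n x - Q (w (j + (j0 + n))%N) x|) by bmauto.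
    by case.
  + by [].
  + apply: measurableT_comp => //; apply: measurable_funB => //.
    by have [] := bmfun_scaling_density n.
  + by [].
  + apply: filterS Qf => x Qfx; apply: cvg_norm; apply: cvgB; first exact: cvg_cst.
    by rewrite (cvg_shiftn (j0 + n) (fun j => Q (w j) x)).
  + move=> j; rewrite -EFin_Rint; last by apply: bmfun_integrable; bmauto.
    rewrite lee_fin; under eq_Rintegral do rewrite distrC.
    have [jw ej _] := wP (j + (j0 + n))%N.
    rewrite (_ : e = 3 * t); last by rewrite /t; field.
    apply: Ex_normB_capped_le => //.
      by rewrite (leq_trans _ jw)// addnA leq_addl.
    have := j0P (j + (j0 + n))%N; rewrite addnCA leq_addr => /(_ isT).
    rewrite -addnCA; have := n0P _ n0n; lra.
- move=> M; apply/lee_addgt0Pr => e e0; have [j0 j0P] := pow0 _ e0.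
  apply: (@fatou_le _ _ _ mu (fun j => kl_integrand (Q (w (j + (j0 + M))%N)) M)).
  + move=> j; apply: measurable_kl_integrand.
    by have [] := bmfun_capped_density (w (j + (j0 + M))) k.
  + by move=> j x; apply: kl_integrand_ge0 => y; exact: ltW.
  + exact: measurable_kl_integrand.
  + by move=> x; exact: kl_integrand_ge0.
  + apply: filterS Qf => x Qfx.
    have {}Qfx : Q (w (j + (j0 + M))%N) x @[j --> \oo] --> f x.
      by rewrite (cvg_shiftn (j0 + M) (fun j => Q (w j) x)).
    rewrite /kl_integrand; apply: cvgD; last exact: cvg_cst.
    apply: cvgB => //; under eq_fun do rewrite mulrBr; rewrite mulrBr.
    apply: cvgB; last by apply: cvgMr_tmp.
    by apply: cvg_xlnx => // j; exact: ltW.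
  + move=> j; rewrite -EFin_Rint; last first.
      by apply: bmfun_integrable; rewrite /kl_integrand; bmauto.
    rewrite -EFinD lee_fin; have [jw ej _] := wP (j + (j0 + M))%N.
    apply: le_trans (Ex_kl_capped_le _) _.
      by rewrite (leq_trans _ jw)// addnA leq_addl.
    rewrite lerD2l (le_trans ej)// ltW// j0P//.
    by rewrite addnCA leq_addr.
Qed.


(** * Balanced densities and the Pythagorean identity *)

Definition balanced (f : T -> R) := [/\ measurable_fun setT f, (forall x, 0 <= f x),
  mu.-integrable setT (EFin \o f), Ex f = 1 &
  forall m, Ex (fun x => g m x * f x) = eps m].

(** [ln (p n)] is the sum of the [g m] with [m < n], each of which integrates to [eps m] against a
    balanced density. Balance is the only trace of feasibility here; the densities of feasible laws
    and the limit density both have it. *)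
Lemma entropy_split f n : balanced f ->
  (\int[mu]_x (f x * ln (f x))%:E =
   (S n)%:E + \int[mu]_x (kl_integrand f n x)%:E)%E.
Proof.
move=> [mf f0 intf Ef Eg].
pose l x := \sum_(m < n) (g m x * f x).
have intl : mu.-integrable setT (EFin \o l).
  rewrite (_ : EFin \o l = (fun x => \sum_(m < n) (g m x * f x)%:E)%E).
    by apply: integrable_sum => // m _; exact: integrable_bmfunM.
  by apply/funext => x /=; rewrite sumEFin.
have intp := bmfun_integrable mu (bmfun_scaling_density n).
have intlf : mu.-integrable setT (EFin \o (fun x => l x + f x)).
  exact: (integrableD measurableT intl intf).
have intw : mu.-integrable setT (EFin \o (fun x => l x + f x - p n x)).
  exact: (integrableB measurableT intlf intp).
have Ew : Ex (fun x => l x + f x - p n x) = S n.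
  rewrite RintegralB// RintegralD// Ef Ex_scaling_density1 addrK.
  rewrite /Rintegral; under eq_integral do rewrite -sumEFin.
  rewrite integral_sum//; last by move=> m; exact: integrable_bmfunM.
  rewrite -sum_fine; last by move=> m _; apply: integrable_fin_num => //; exact: integrable_bmfunM.
  by apply: eq_bigr => m _; exact: Eg.
rewrite addeC -Ew EFin_Rint// -ge0_integralD_integrable//.
- apply: eq_integral => x _; congr EFin.
  by rewrite /kl_integrand ln_scaling_density /l -mulr_suml; ring.
- exact: measurable_kl_integrand.
- by move=> x; exact: kl_integrand_ge0.
Qed.

(** Dropping the Hellinger term bounds [S n] by the entropy of any balanced density. Keeping it
    forces a balanced density of entropy at most the limit of [S] to be the limit of the [p n],
    which gives uniqueness. *)
Lemma hellinger_le_entropy_gap f n : balanced f ->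
  ((S n)%:E + \int[mu]_x (sqr_hellinger f (p n) x)%:E <=
   \int[mu]_x (f x * ln (f x))%:E)%E.
Proof.
move=> bf; have [mf f0 _ _ _] := bf; rewrite (entropy_split n bf) leeD2l//.
apply: ge0_le_integral => //.
- by move=> x _; rewrite lee_fin sqr_ge0.
- apply/measurable_EFinP; apply: measurable_funX; apply: measurable_funB.
    by apply: (@measurableT_comp _ _ _ _ _ _ (@Num.sqrt R)) mf;
      apply: continuous_measurable_fun; exact: sqrt_continuous.
  by have [] := bmfun_sqrt (bmfun_scaling_density n).
- by apply/measurable_EFinP; exact: measurable_kl_integrand.
- by move=> x _; rewrite lee_fin; exact: hellinger_le_entropy.
Qed.

Section limit_density.
Variable f : T -> R.
Hypothesis mf : measurable_fun setT f.
Hypothesis f0 : forall x, 0 <= f x.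
Hypothesis pf : forall e : R, 0 < e -> exists n0, forall n, (n0 <= n)%N ->
  (\int[mu]_x (`|p n x - f x|)%:E <= e%:E)%E.

Let int_pf n : (\int[mu]_x (`|p n x - f x|)%:E < +oo)%E ->
  mu.-integrable setT (EFin \o (fun x => p n x - f x)).
Proof.
move=> h; apply/integrableP; split => //.
by apply/measurable_EFinP/measurable_funB => //; have [] := bmfun_scaling_density n.
Qed.

Lemma limit_integrable : mu.-integrable setT (EFin \o f).
Proof.
have [n0 /(_ n0 (leqnn _)) n0P] := pf ltr01.
have := integrableB measurableT (bmfun_integrable mu (bmfun_scaling_density n0))
  (int_pf (le_lt_trans n0P (ltry _))).
by apply: eq_integrable => // x _ /=; rewrite -EFinB; congr EFin; ring.
Qed.

(** A constraint is met exactly by the iterates that follow its own steps, so the equality is asked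
    at arbitrarily late [n] and not at all large [n]. L1 convergence and the boundedness of [h]
    carry it to the limit. *)
Lemma limit_Ex h c : bmfun h ->
  (forall n0, exists2 n, (n0 <= n)%N & Ex (fun x => h x * p n x) = c) ->
  Ex (fun x => h x * f x) = c.
Proof.
move=> bh hc; have [mh [b hb]] := bh.
have intf := limit_integrable.
apply/eqP; rewrite -subr_eq0 -normr_eq0 eq_le normr_ge0 andbT.
apply/ler_addgt0Pr => e e0; rewrite add0r.
have b1 : 0 < `|b| + 1 by rewrite ltr_wpDl.
have [n0 n0P] := pf (divr_gt0 e0 b1).
have [n n0n <-] := hc n0; have {}n0P := n0P _ n0n.
have intd := int_pf (le_lt_trans n0P (ltry _)).
rewrite -RintegralB//; [|exact: integrable_bmfunM|]; last first.
  by apply: bmfun_integrable; bmauto.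
have intB : mu.-integrable setT (EFin \o (fun x => h x * f x - h x * p n x)).
  exact: (integrableB measurableT (integrable_bmfunM bh intf)
    (bmfun_integrable mu (bmfunM bh (bmfun_scaling_density n)))).
have intn := integrable_norm intd.
apply: (le_trans (le_normr_Rintegral _ intB)) => //.
apply: (@le_trans _ _ (Ex (fun x => (`|b| + 1) * `|p n x - f x|))).
  apply: le_Rintegral => //.
  - exact: integrable_norm intB.
  - exact: (@integrableZl _ _ _ _ _ measurableT (`|b| + 1) _ intn).
  - move=> x _; rewrite -mulrBr normrM distrC ler_wpM2r//.
    by rewrite (le_trans (hb x))// (le_trans (ler_norm _))// lerDl.
rewrite RintegralZl// mulrC -ler_pdivlMr// -lee_fin.
by rewrite EFin_Rint.
Qed.

Lemma limit_balanced : balanced f.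
Proof.
split => //; first exact: limit_integrable.
  have := @limit_Ex (fun=> 1) 1 (bmfun_cst _ _); under eq_Rintegral do rewrite mul1r.
  apply => n0; exists n0 => //; under eq_Rintegral do rewrite mul1r.
  exact: Ex_scaling_density1.
(* Step [m + n0 * k] uses the same map as step [m]. *)
move=> m; apply: limit_Ex => // n0; exists (m + n0 * k).+1.
  by rewrite leqW// (leq_trans (leq_pmulr n0 k_gt0))// leq_addl.
apply: (@Ex_cycle m _ id); last by move=> x; exact: cvg_id.
by rewrite addnC modnMDl.
Qed.

(** The factor [1 + L] is harmless: in [entropy_split] at a late [n0] it multiplies a tail that is
    as small as desired. *)
Lemma limit_entropy :
  (forall M, (\int[mu]_x (kl_integrand f M x)%:E <=
     ((1 + L) * (Slim - S M))%:E)%E) ->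
  (\int[mu]_x (f x * ln (f x))%:E <= Slim%:E)%E.
Proof.
move=> fM; apply/lee_addgt0Pr => e e0; have [n0 n0P] := tail_lt e0.
rewrite (entropy_split n0 limit_balanced) leeD ?lee_fin ?total_gain_le_lim//.
by rewrite (le_trans (fM n0))// lee_fin ltW// n0P.
Qed.

End limit_density.

End iterated_scaling.

(** * Densities and disintegrations *)

Section densities.
Context d (T : measurableType d) (R : realType).
Implicit Types (P : {measure set T -> \bar R})
  (Q : {sigma_finite_measure set T -> \bar R}).

Definition has_density P Q (h : T -> R) :=
  forall A, measurable A -> P A = \int[Q]_(x in A) (h x)%:E.

Lemma density_null_dominates P Q h : measurable_fun setT h ->
  has_density P Q h -> P `<< Q.
Proof.
move=> mh Ph; apply/null_content_dominatesP => A mA QA0; rewrite Ph//.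
by apply: null_set_integral => //; apply/measurable_EFinP; exact: measurable_funTS.
Qed.

Section density_integral.
Variables (P : {measure set T -> \bar R}) (Q : {sigma_finite_measure set T -> \bar R}).
Variable h : T -> R.
Hypothesis PT : P setT < +oo.
Hypothesis mh : measurable_fun setT h.
Hypothesis h0 : forall x, (0 <= h x)%R.
Hypothesis Ph : has_density P Q h.

(** Radon-Nikodym derivatives are taken of finite measures, so [P] is repackaged as its restriction
    to the whole space. *)
Let Pf : {finite_measure set T -> \bar R} := mfrestr measurableT PT.

Let PfE A : measurable A -> A `<=` setT -> Pf A = P A.
Proof. by move=> mA _; rewrite /Pf/= /mfrestr /mrestr setIT. Qed.

Let PfQ : Pf `<< Q.
Proof.
move/null_content_dominatesP: (density_null_dominates mh Ph) => PQ.
by apply/null_content_dominatesP => A mA /PQ; rewrite PfE//; exact.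
Qed.

Let ae_density :
  ae_eq Q setT (Radon_Nikodym_SigmaFinite.f Pf Q) (EFin \o h).
Proof.
apply: integral_ae_eq => //.
- exact: Radon_Nikodym_SigmaFinite.f_integrable.
- exact/measurable_EFinP.
- move=> E _ mE; rewrite -Radon_Nikodym_SigmaFinite.f_integral// PfE//.
  exact: Ph.
Qed.

Lemma ge0_density_integral (u : T -> \bar R) : measurable_fun setT u ->
  (forall x, 0 <= u x) -> \int[P]_x u x = \int[Q]_x (u x * (h x)%:E).
Proof.
move=> mu_ u0; rewrite (eq_measure_integral Pf); last first.
  by move=> A mA AT; exact/esym/PfE.
rewrite -(Radon_Nikodym_SigmaFinite.change_of_variables PfQ)//.
have mf := measurable_int _ (Radon_Nikodym_SigmaFinite.f_integrable PfQ).
apply: ge0_ae_eq_integral => //.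
- exact: emeasurable_funM.
- by apply: emeasurable_funM => //; exact/measurable_EFinP.
- by move=> x _; rewrite mule_ge0// Radon_Nikodym_SigmaFinite.f_ge0.
- by move=> x _; rewrite mule_ge0// lee_fin.
- by apply: filterS ae_density => x /(_ I) hx _; rewrite hx.
Qed.

Lemma density_integral (u : T -> R) : measurable_fun setT u ->
  \int[P]_x (u x)%:E = \int[Q]_x (u x * h x)%:E.
Proof.
move=> mu_; have mEu : measurable_fun setT (EFin \o u) by exact/measurable_EFinP.
rewrite integralE [in RHS]integralE; congr (_ - _).
  rewrite ge0_density_integral//; last exact: measurable_funepos.
  apply: eq_integral => x _; rewrite !funeposE -!EFin_max -EFinM.
  by rewrite maxr_pMl// mul0r.
rewrite ge0_density_integral//; last exact: measurable_funeneg.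
apply: eq_integral => x _; rewrite !funenegE -!EFinN -!EFin_max -EFinM.
by rewrite maxr_pMl// mul0r mulNr.
Qed.

End density_integral.

Lemma exists_density P Q : P setT < +oo -> P `<< Q ->
  exists h : T -> R, [/\ measurable_fun setT h, (forall x, (0 <= h x)%R) & has_density P Q h].
Proof.
move=> PT /null_content_dominatesP PQ.
pose Pf : {finite_measure set T -> \bar R} := mfrestr measurableT PT.
have PfE A : Pf A = P A by rewrite /Pf/= /mfrestr /mrestr setIT.
have PfQ : Pf `<< Q.
  by apply/null_content_dominatesP => A mA /PQ; rewrite PfE; exact.
pose f := Radon_Nikodym_SigmaFinite.f Pf Q.
have fE x : (fine (f x))%:E = f x.
  by rewrite fineK// Radon_Nikodym_SigmaFinite.f_fin_num.
exists (fine \o f); split.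
- apply/measurable_EFinP; rewrite (_ : EFin \o _ = f); last exact/funext.
  exact: measurable_int (Radon_Nikodym_SigmaFinite.f_integrable PfQ).
- by move=> x /=; rewrite fine_ge0// Radon_Nikodym_SigmaFinite.f_ge0.
- move=> A mA; under eq_integral do rewrite /= fE.
  by rewrite -Radon_Nikodym_SigmaFinite.f_integral// PfE.
Qed.

(** Split [A] along [B]. This is used to clamp a density, one bound at a time. *)
Lemma density_modify P Q (h h' : T -> R) B : measurable B ->
  measurable_fun setT h -> (forall x, (0 <= h x)%R) ->
  measurable_fun setT h' -> (forall x, (0 <= h' x)%R) ->
  has_density P Q h -> (forall x, ~ B x -> h' x = h x) ->
  (forall A, measurable A -> A `<=` B -> P A = \int[Q]_(x in A) (h' x)%:E) ->
  has_density P Q h'.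
Proof.
move=> mB mh h0 mh' h'0 Ph h'h PB A mA.
have mEh' D : measurable_fun D (EFin \o h').
  exact/measurable_EFinP/measurable_funTS.
have mAB : measurable (A `&` B) by exact: measurableI.
have mADB : measurable (A `\` B) by exact: measurableD.
have -> : P A = P (A `\` B) + P (A `&` B) by exact: measureDI.
rewrite -[in RHS](setUIDK A B) ge0_integral_setU//.
- rewrite -(PB _ mAB); last by move=> x [].
  rewrite addeC (Ph _ mADB); congr (_ + _).
  by apply: eq_integral => x; rewrite inE => -[_ Bx]; rewrite h'h.
- by move=> x _; rewrite lee_fin.
- by rewrite disj_set2E -setIA setDIK setI0.
Qed.

(** Clamp any density. On a set [A] where [h >= b], the integral of [h] is at least [b * Q A] and
    equals [P A <= b * Q A], so replacing [h] by [b] there changes no integral; the bound [a] is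
    symmetric. The bounds then hold everywhere and not only almost everywhere. *)
Lemma exists_bounded_density P Q (a b : R) : P setT < +oo -> P `<< Q ->
  (0 <= a <= b)%R ->
  (forall A, measurable A -> a%:E * Q A <= P A) ->
  (forall A, measurable A -> P A <= b%:E * Q A) ->
  exists h : T -> R,
    [/\ measurable_fun setT h, (forall x, (a <= h x <= b)%R) & has_density P Q h].
Proof.
move=> PT PQ /andP[a0 ab] aP Pb; have [h [mh h0 Ph]] := exists_density PT PQ.
pose h1 x := Num.min (h x) b; pose h2 x := Num.max (h1 x) a.
have mh1 : measurable_fun setT h1 by exact: measurable_minr.
have mh2 : measurable_fun setT h2 by exact: measurable_maxr.
have h10 x : (0 <= h1 x)%R by rewrite le_min h0 (le_trans a0).
have h20 x : (0 <= h2 x)%R by rewrite le_max h10.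
have mE (u : T -> R) A : measurable_fun setT u -> measurable_fun A (EFin \o u).
  by move=> mu_; exact/measurable_EFinP/measurable_funTS.
have Ph1 : has_density P Q h1.
  apply: (@density_modify P Q h h1 [set x | (b <= h x)%R]) => //.
  - by rewrite -[X in measurable X]setTI; exact: measurable_fun_le.
  - by move=> x /negP; rewrite -ltNge => /ltW hb; rewrite /h1 min_l.
  - move=> A mA Ab; apply/eqP; rewrite eq_le; apply/andP; split; last first.
      rewrite Ph//; apply: ge0_le_integral => //; [|exact: mE|exact: mE|].
      + by move=> x _; rewrite lee_fin.
      + by move=> x _; rewrite lee_fin ge_min lexx.
    rewrite (le_trans (Pb _ mA))// -integral_cst//.
    rewrite (eq_integral (fun x => (h1 x)%:E))// => x /[!inE] /Ab/= bh.
    by rewrite /h1 min_r.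
exists h2; split => //.
  by move=> x; rewrite le_max lexx orbT ge_max ge_min lexx orbT.
apply: (@density_modify P Q h1 h2 [set x | (h1 x <= a)%R]) => //.
- by rewrite -[X in measurable X]setTI; exact: measurable_fun_le.
- by move=> x /negP; rewrite -ltNge => /ltW hb; rewrite /h2 max_l.
- move=> A mA Ab; apply/eqP; rewrite eq_le; apply/andP; split.
    rewrite Ph1//; apply: ge0_le_integral => //; [|exact: mE|exact: mE|].
    + by move=> x _; rewrite lee_fin.
    + by move=> x _; rewrite lee_fin le_max lexx.
  rewrite (le_trans _ (aP _ mA))// -integral_cst//.
  rewrite (eq_integral (fun x => (h2 x)%:E))// => x /[!inE] /Ab/= bh.
  by rewrite /h2 max_r.
Qed.

(* Since [ln 0 = 0], the integrand is [0] where [h] vanishes, although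
   [lne 0 = -oo] in the definition of [KL]. *)
Lemma KL_density (P Q : probability T R) (h : T -> R) : measurable_fun setT h ->
  (forall x, (0 <= h x)%R) -> has_density P Q h ->
  KL P Q = \int[Q]_x (h x * ln (h x))%:E.
Proof.
move=> mh h0 Ph; have PQ := density_null_dominates mh Ph.
have PT : P setT < +oo by rewrite -ge0_fin_numE// fin_num_measure.
rewrite /KL; case: ifPn => [_|/asboolP//].
set f := 'd _ '/d _.
have aef : ae_eq Q setT f (EFin \o h).
  apply: integral_ae_eq => //.
  - exact: Radon_Nikodym_integrable.
  - exact/measurable_EFinP.
  - by move=> E _ mE; rewrite -Radon_Nikodym_integral//; exact: Ph.
have hpos : {ae P, forall x, (0 < h x)%R}.
  exists [set x | (h x <= 0)%R]; split.
  - by rewrite -[X in measurable X]setTI; apply: measurable_fun_le => //.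
  - rewrite Ph; last by rewrite -[X in measurable X]setTI; apply: measurable_fun_le.
    apply: integral0_eq => x /=; rewrite le_eqVlt ltNge h0 orbF => /eqP ->//.
  - by move=> x /= /negP; rewrite -leNgt.
rewrite (@ae_eq_integral _ _ _ P setT (fun x => (ln (h x))%:E))//.
- rewrite (density_integral PT mh h0 Ph); last exact: measurableT_comp.
  by apply: eq_integral => x _; rewrite mulrC.
- have fE x : f x = (fine (f x))%:E.
    by rewrite fineK// Radon_Nikodym_fin_num.
  have mf : measurable_fun setT (fine \o f).
    by apply: measurableT_comp => //; exact: measurable_int (Radon_Nikodym_integrable _).
  rewrite (_ : (fun x => lne (f x)) = (fun x =>
      if (fine (f x) <= 0)%R then -oo else (ln (fine (f x)))%:E)); last first.
    by apply/funext => x; rewrite {1}fE.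
  apply: measurable_fun_ifT => //.
    exact: measurable_fun_ler.
  by apply/measurable_EFinP; exact: measurableT_comp.
- by apply/measurable_EFinP; exact: measurableT_comp.
- have := null_dominates_ae_eq measurableT PQ aef.
  apply: filterS2 hpos => x hx /(_ I) fx _; rewrite fx.
  by rewrite lne_EFin.
Qed.

End densities.

(** * A DCI update as a reweighting *)

Section dci_update.
Context d d' (T : measurableType d) (D : measurableType d') (R : realType).
Variables (P : probability T R) (phi : {mfun T >-> D}) (K : R.-pker D ~> T).
Hypothesis measurable_point : forall w : D, measurable [set w].
Hypothesis PK : disintegration P phi K.

Let mpre B : measurable B -> measurable (phi @^-1` B).
Proof. by move=> mB; exact: measurable_funPTI. Qed.

(** [K w] is carried by the fibre over [w], which lies inside the preimage of [B] or is disjoint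
    from it according to whether [w] belongs to [B]. *)
Lemma kernel_fiber A B : measurable A -> measurable B ->
  {ae distribution P phi, forall w,
    K w (phi @^-1` B `&` A) = (\1_B w)%:E * K w A}.
Proof.
move=> mA mB; case: PK => aeK _; apply: filterS aeK => w Kw.
have mAB : measurable (phi @^-1` B `&` A) by apply: measurableI => //; exact: mpre.
have null C : measurable C -> C `<=` ~` (phi @^-1` [set w]) -> K w C = 0.
  move=> mC Cw; apply: (subset_measure0 mC _ Cw Kw).
  by apply: measurableC; exact: mpre.
rewrite indicE; case: (boolP (w \in B)) => [/[!inE] Bw|wB].
  rewrite mul1e; have -> : K w A = K w (A `\` phi @^-1` B) + K w (A `&` phi @^-1` B).
    by apply: measureDI => //; exact: mpre.
  have -> : K w (A `\` phi @^-1` B) = 0.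
    apply: null; first by apply: measurableD => //; exact: mpre.
    by move=> x [_ nB] /= xw; apply: nB; rewrite /= xw.
  by rewrite add0e setIC.
rewrite mul0e null// => x [/= Bx _] xw; move/negP: wB; apply.
by rewrite inE -xw.
Qed.

Let fineK_ker A w : measurable A -> (fine (K w A))%:E = K w A.
Proof.
move=> mA; rewrite fineK// ge0_fin_numE// (@le_lt_trans _ _ (K w setT))//.
  by apply: le_measure => //; rewrite inE.
by rewrite prob_kernel ltry.
Qed.

Definition joint_law (A : set T) (mA : measurable A) : {measure set D -> \bar R}.
Proof.
refine (pushforward (mrestr P mA) phi : {measure set D -> \bar R}).
exact: measurable_funP.
Defined.

(** In other words, [K w A] is the conditional probability of [A] given [phi = w]. This turns
    integrals over [D] against the kernel into integrals over [T]. *)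
Lemma joint_density A (mA : measurable A) :
  has_density (joint_law mA) (distribution P phi)
    (fun w => fine (K w A)).
Proof.
move=> B mB; transitivity (P (phi @^-1` B `&` A)); first by [].
have mBA : measurable (phi @^-1` B `&` A) by apply: measurableI => //; exact: mpre.
have [_ /(_ _ mBA) ->] := PK.
have mK C : measurable C -> measurable_fun setT (fun w => K w C).
  exact: measurable_kernel.
rewrite (_ : \int[_]_(w in B) _ = \int[distribution P phi]_w ((\1_B w)%:E * K w A)).
  apply: ge0_ae_eq_integral => //.
  - exact: mK.
  - apply: emeasurable_funM; last exact: mK.
    by apply/measurable_EFinP; exact: measurable_indic.
  - by apply: filterS (kernel_fiber mA mB) => w Kw _.
rewrite integral_mkcond; apply: eq_integral => w _.
rewrite patchE indicE; case: ifPn => wB; last by rewrite mul0e.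
by rewrite mul1e fineK_ker.
Qed.

Section reweighting.
Variables (Pobs : probability D R) (rho : D -> R).
Hypothesis mrho : measurable_fun setT rho.
Hypothesis rho0 : forall w, (0 <= rho w)%R.
Hypothesis Prho : has_density Pobs (distribution P phi) rho.

Let mrhophi : measurable_fun setT (fun x => rho (phi x)).
Proof. exact: measurableT_comp. Qed.

(** Write [Pobs] as [rho] times the marginal of [P], absorb [K w A] into [joint_law mA], and pull
    back along [phi]. The right-hand side does not depend on the choice of the disintegration. *)
Lemma dci_density A : measurable A ->
  \int[Pobs]_w K w A = \int[P]_(x in A) (rho (phi x))%:E.
Proof.
move=> mA; have mK : measurable_fun setT (fun w => K w A) by exact: measurable_kernel.
rewrite (ge0_density_integral _ mrho rho0 Prho)//; last first.
  by apply: le_lt_trans (ltry 1); exact: probability_le1.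
have -> : \int[distribution P phi]_w (K w A * (rho w)%:E) =
    \int[joint_law mA]_w (rho w)%:E.
  rewrite (ge0_density_integral _ _ _ (joint_density mA))//.
  - by apply: eq_integral => w _; rewrite fineK_ker// muleC.
  - rewrite [X in X < _]/(P (phi @^-1` setT `&` A)) preimage_setT setTI.
    by apply: le_lt_trans (ltry 1); exact: probability_le1.
  - exact: measurableT_comp.
  - exact/measurable_EFinP.
rewrite ge0_integral_pushforward//; last 2 first.
- exact/measurable_EFinP.
- by move=> w _; rewrite lee_fin.
rewrite preimage_setT (ge0_density_integral (Q := P) (h := \1_A))//.
- rewrite [RHS]integral_mkcond; apply: eq_integral => x _ /=.
  rewrite patchE indicE; case: ifPn => xA; first by rewrite mule1.
  by rewrite mule0.
- apply: (@le_lt_trans _ _ (P (setT `&` A))); first exact: lexx.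
  by rewrite setTI; apply: le_lt_trans (ltry 1); exact: probability_le1.
- by move=> B mB; rewrite integral_indic//= setIC.
- exact/measurable_EFinP.
- by move=> x; rewrite lee_fin.
Qed.

Lemma reweighted_marginal B : measurable B ->
  \int[P]_(x in phi @^-1` B) (rho (phi x))%:E = Pobs B.
Proof.
move=> mB; rewrite Prho// /distribution ge0_integral_pushforward//.
- exact/measurable_EFinP/measurable_funTS.
- by move=> w _; rewrite lee_fin.
Qed.

End reweighting.

End dci_update.

Section density_probability.
Context d (T : measurableType d) (R : realType) (mu : probability T R).
Variable f : T -> R.
Hypothesis mf : measurable_fun setT f.
Hypothesis f0 : forall x, (0 <= f x)%R.
Hypothesis f1 : \int[mu]_x (f x)%:E = 1.

Let nu (A : set T) : \bar R := \int[mu]_(x in A) (f x)%:E.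

Let nu0 : nu set0 = 0. Proof. exact: integral_set0. Qed.

Let nu_ge0 A : 0 <= nu A.
Proof. by apply: integral_ge0 => x _; rewrite lee_fin. Qed.

Let nu_sigma_additive : semi_sigma_additive nu.
Proof.
move=> F mF tF mUF; rewrite /nu ge0_integral_bigcup//.
- apply: is_cvg_ereal_nneg_natsum_cond => n _ _.
  by apply: integral_ge0 => x _; rewrite lee_fin.
- exact/measurable_EFinP/measurable_funTS.
- by move=> x _; rewrite lee_fin.
Qed.

Lemma exists_probability_of_density :
  exists Q : probability T R, has_density Q mu f.
Proof.
pose nu_measure : {measure set T -> \bar R} :=
  HB.pack nu (isMeasure.Build _ _ _ nu nu0 nu_ge0 nu_sigma_additive).
pose nu_prob : probability T R :=
  HB.pack nu nu_measure (Measure_isProbability.Build _ _ _ nu_measure f1).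
by exists nu_prob.
Qed.

End density_probability.

(** * Total variation and densities *)

Section total_variation.
Context d (T : measurableType d) (R : realType) (mu : probability T R).
Implicit Types f h : T -> R.

Lemma density_dist (P Q : probability T R) f h A :
  has_density P mu f -> has_density Q mu h ->
  mu.-integrable setT (EFin \o f) -> mu.-integrable setT (EFin \o h) ->
  measurable A -> `|P A - Q A| <= \int[mu]_x (`|f x - h x|)%:E.
Proof.
move=> Pf Qh intf inth mA; rewrite Pf// Qh//.
have intfA : mu.-integrable A (EFin \o f) by exact: (integrableS measurableT).
have inthA : mu.-integrable A (EFin \o h) by exact: (integrableS measurableT).
rewrite -integralB_EFin//.
have mfh : measurable_fun setT (fun x => (f x - h x)%:E).
  exact: measurable_int (integrableB measurableT intf inth).
apply: le_trans (le_abse_integral mu mA _) _.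
  exact: measurable_funTS.
apply: ge0_subset_integral => //.
exact: measurableT_comp.
Qed.

Lemma tv_dist_le (P Q : probability T R) f h (e : \bar R) :
  has_density P mu f -> has_density Q mu h ->
  mu.-integrable setT (EFin \o f) -> mu.-integrable setT (EFin \o h) ->
  \int[mu]_x (`|f x - h x|)%:E <= e -> tv_dist P Q <= e.
Proof.
move=> Pf Qh intf inth fh; apply: ge_ereal_sup => _ [A mA <-].
exact: le_trans (density_dist Pf Qh intf inth mA) fh.
Qed.

Lemma tv_dist_ge0 (Q Q' : probability T R) : 0 <= tv_dist Q Q'.
Proof.
apply: ereal_sup_ubound; exists set0 => //.
by rewrite !measure0 sube0 abse0.
Qed.

Lemma le_tv_dist (Q Q' : probability T R) A : measurable A -> `|Q A - Q' A| <= tv_dist Q Q'.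
Proof. by move=> mA; apply: ereal_sup_ubound; exists A. Qed.

End total_variation.

(** * Iterative DCI sequences *)

Section iterative_DCI_densities.
Context d (T : measurableType d) (R : realType) (k : nat)
  (dD : 'I_k -> measure_display) (D : forall i, measurableType (dD i)).
Variables (phi : forall i, {mfun T >-> D i}) (Pobs : forall i, probability (D i) R)
  (Pinit : probability T R) (P : nat -> probability T R).
Hypothesis k_gt0 : (0 < k)%N.
Hypothesis measurable_point : forall i (w : D i), measurable [set w].
Hypothesis P_DCI : iterative_DCI phi Pobs Pinit P.
Hypothesis feas : exists P', feasible phi Pobs Pinit P'.
Variable C : R.
Hypothesis C_gt0 : (0 < C)%R.
Hypothesis density_bounds : forall i,
  {ae distribution Pinit (phi i), forall w,
    (C^-1)%:E <=
      ('d (charge_of_finite_measure (Pobs i)) '/d (distribution Pinit (phi i))) w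
      <= C%:E}.

(** Steps and constraints are both numbered from 0: the step from [P n] to [P n.+1] uses constraint
    [n] modulo [k]. *)
Definition constraint n : 'I_k := Ordinal (ltn_pmod n k_gt0).
Local Notation idx := constraint.

Let mpre i B : measurable B -> measurable (phi i @^-1` B).
Proof. by move=> mB; exact: measurable_funPTI. Qed.

(** A feasible law is dominated by [Pinit] and has the observed marginals; domination passes to the
    marginals. This is what gives the derivative in [density_bounds] its meaning. *)
Lemma Pobs_dominated i : Pobs i `<< distribution Pinit (phi i).
Proof.
apply/null_content_dominatesP => B mB QB; have [P' [P'P0 P'obs]] := feas.
rewrite -P'obs//; move/null_content_dominatesP : P'P0; apply => //.
exact: mpre.
Qed.

Lemma Pobs_bounds i B : measurable B ->
  (C^-1)%:E * distribution Pinit (phi i) B <= Pobs i B <=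
    C%:E * distribution Pinit (phi i) B.
Proof.
move=> mB; set Q := distribution _ _.
pose f := 'd (charge_of_finite_measure (Pobs i)) '/d Q.
have dom : charge_of_finite_measure (Pobs i) `<< Q by exact: Pobs_dominated.
have mf : measurable_fun setT f.
  exact: measurable_int (Radon_Nikodym_integrable dom).
(* [f] is the derivative of a charge, here nonnegative almost everywhere by [density_bounds]; the
   absolute value makes it so everywhere. *)
have -> : Pobs i B = \int[Q]_(x in B) `|f x|.
  transitivity (\int[Q]_(x in B) f x).
    exact: (Radon_Nikodym_integral dom mB).
  apply: ae_eq_integral => //.
  - exact: measurable_funTS.
  - by apply: measurableT_comp => //; exact: measurable_funTS.
  - apply: filterS (density_bounds i) => w /andP[fC _] _; rewrite gee0_abs//.
    by apply: le_trans fC; rewrite lee_fin invr_ge0 ltW.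
have C'0 : (0 <= C^-1)%R by rewrite invr_ge0 ltW.
have mabs : measurable_fun B (fun x => `|f x|).
  by apply: measurableT_comp => //; exact: measurable_funTS.
apply/andP; split.
  rewrite -integral_cst//; apply: ae_ge0_le_integral => //.
  by apply: filterS (density_bounds i) => w /andP[fC _] _; rewrite (le_trans fC)// lee_abs.
rewrite -integral_cst//; apply: ae_ge0_le_integral => //.
- by move=> x _; rewrite lee_fin ltW.
- apply: filterS (density_bounds i) => w /andP[fC fC'] _; rewrite gee0_abs//.
  by apply: le_trans fC; rewrite lee_fin.
Qed.

(** The constants may deteriorate from step to step; they serve to make each single log-ratio
    bounded. *)
Definition comparable_to_init (Q : probability T R) := exists l u : R,
  (0 < l)%R /\ forall A, measurable A -> l%:E * Pinit A <= Q A <= u%:E * Pinit A.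

Lemma DCI_step_density n : comparable_to_init (P n) ->
  exists rho : D (idx n) -> R, [/\ bmfun rho,
    (exists2 a, 0 < a & forall w, a <= rho w)%R,
    has_density (Pobs (idx n)) (distribution (P n) (phi (idx n))) rho &
    forall A, measurable A -> P n.+1 A = \int[P n]_(x in A) (rho (phi (idx n) x))%:E].
Proof.
move=> [l [u [l0 PnP0]]]; set i := idx n.
pose Q : probability (D i) R := distribution (P n) (phi i).
have QT : Q setT = 1 by exact: probability_setT.
have u1 : (1 <= u)%R.
  have /andP[_] := PnP0 _ measurableT.
  by rewrite !probability_setT mule1 lee_fin.
have u0 : (0 < u)%R by exact: lt_le_trans u1.
(* [Pobs i] lies between [C^-1] and [C] times the initial marginal, and [Q] between [l] and [u]
   times it; hence [Pobs i] lies between [a] and [b] times [Q]. *)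
pose a := (C^-1 / u)%R; pose b := (C / l)%R.
have a0 : (0 < a)%R by rewrite divr_gt0// invr_gt0.
have b0 : (0 < b)%R by rewrite divr_gt0.
have aQ B : measurable B -> a%:E * Q B <= Pobs i B.
  move=> mB; have /andP[+ _] := Pobs_bounds mB; apply: le_trans.
  rewrite /a EFinM -muleA lee_pmul2l ?lte_fin ?invr_gt0//.
  rewrite muleC lee_pdivrMr//.
  by have /andP[_] := PnP0 _ (mpre mB); rewrite muleC.
have Qb B : measurable B -> Pobs i B <= b%:E * Q B.
  move=> mB; have /andP[_ ?] := Pobs_bounds mB; apply: le_trans; first eassumption.
  rewrite /b EFinM -muleA lee_pmul2l// muleC lee_pdivlMr//.
  by have /andP[+ _] := PnP0 _ (mpre mB); rewrite muleC.
have ab : (a <= b)%R.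
  have := le_trans (aQ _ measurableT) (Qb _ measurableT).
  by rewrite QT !mule1 lee_fin.
have dom : Pobs i `<< Q.
  apply/null_content_dominatesP => B mB QB; apply/eqP; rewrite eq_le measure_ge0 andbT.
  by have := Qb _ mB; rewrite QB mule0.
have [||rho [mrho rhoab Qrho]] := @exists_bounded_density _ _ _ (Pobs i) Q a b _ dom _ aQ Qb.
- by apply: le_lt_trans (ltry 1); exact: probability_le1.
- by rewrite ltW.
have rho0 w : (0 <= rho w)%R.
  by have /andP[+ _] := rhoab w; apply: le_trans; exact: ltW.
exists rho; split => //.
- split => //; exists b => w; rewrite ger0_norm//.
  by have /andP[] := rhoab w.
- by exists a => // w; have /andP[] := rhoab w.
- move=> A mA; have [_ /(_ n i)] := P_DCI.
  (* The index condition of [iterative_DCI] reads [n.+1 = (n %% k).+1] modulo [k]. *)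
  rewrite -addn1 -[in X in (_ = X %[mod _])]addn1 /= modnDml => /(_ erefl)[K PK ->//].
  exact: dci_density.
Qed.

Lemma iterate_comparable_to_init n : comparable_to_init (P n).
Proof.
elim: n => [|n IH].
  by exists 1%R, 1%R; split => // A mA; have [-> _] := P_DCI; rewrite mul1e lexx.
have [rho [[mrho [b rhob]] [a a0 rhoa] _ PS]] := DCI_step_density IH.
have [l [u [l0 PnP0]]] := IH.
have b0 : (0 <= b)%R by apply: le_trans (rhob point).
have rho0 w : (0 <= rho w)%R by apply: le_trans (rhoa w); exact: ltW.
exists (a * l)%R, (b * u)%R; split => [|A mA]; first exact: mulr_gt0.
have mr : measurable_fun A (fun x => (rho (phi (idx n) x))%:E).
  by apply/measurable_EFinP/measurable_funTS; exact: measurableT_comp.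
have /andP[lP Pu] := PnP0 _ mA.
rewrite PS// !EFinM -!muleA; apply/andP; split.
  apply: (@le_trans _ _ (a%:E * P n A)); first by rewrite lee_pmul2l.
  rewrite -integral_cst//; apply: ge0_le_integral => //.
  - by move=> x _; rewrite lee_fin ltW.
  - by move=> x _; rewrite lee_fin.
apply: (@le_trans _ _ (b%:E * P n A)); last by rewrite lee_wpmul2l.
rewrite -integral_cst//; apply: ge0_le_integral => //.
- by move=> x _; rewrite lee_fin.
- by move=> x _; rewrite lee_fin (le_trans (ler_norm _)).
Qed.

Lemma exists_log_ratios : exists g : nat -> T -> R, forall n,
  [/\ bmfun (g n), (exists2 gam : D (idx n) -> R, bmfun gam & g n = gam \o phi (idx n)),
    (forall A, measurable A -> P n.+1 A = \int[P n]_(x in A) (expR (g n x))%:E) &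
    forall B, measurable B -> distribution (P n.+1) (phi (idx n)) B = Pobs (idx n) B].
Proof.
suff /boolp.choice [g gP] : forall n, exists g : T -> R, [/\ bmfun g,
    (exists2 gam : D (idx n) -> R, bmfun gam & g = gam \o phi (idx n)),
    (forall A, measurable A -> P n.+1 A = \int[P n]_(x in A) (expR (g x))%:E) &
    forall B, measurable B -> distribution (P n.+1) (phi (idx n)) B = Pobs (idx n) B].
  by exists g.
move=> n.
have [rho [[mrho [b rhob]] [a a0 rhoa] Qrho PS]] :=
  DCI_step_density (iterate_comparable_to_init n).
have rho_gt0 w : (0 < rho w)%R by exact: lt_le_trans (rhoa w).
have bgam : bmfun (fun w => ln (rho w)).
  split; first exact: measurableT_comp.
  exists (`|ln a| + `|ln b|)%R => w.
  have h1 : (ln a <= ln (rho w))%R by rewrite ler_ln ?posrE// rhoa.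
  have h2 : (ln (rho w) <= ln b)%R.
    have rb : (rho w <= b)%R by exact: le_trans (ler_norm _) (rhob w).
    by rewrite ler_ln ?posrE// (lt_le_trans (rho_gt0 w)).
  have := ler_norm (ln b); have := ler_norm (- ln a); rewrite normrN.
  have := normr_ge0 (ln a); have := normr_ge0 (ln b).
  by move=> h3 h4 h5 h6; rewrite ler_norml; apply/andP; split; lra.
exists (fun x => ln (rho (phi (idx n) x))); split.
- case: bgam => mgam [c gamc]; split; first exact: measurableT_comp mgam _.
  by exists c => x; exact: gamc.
- by exists (fun w => ln (rho w)).
- move=> A mA; rewrite PS//; apply: eq_integral => x _.
  by rewrite lnK ?posrE.
- move=> B mB; transitivity (P n.+1 (phi (idx n) @^-1` B)); first by [].
  rewrite PS; last exact: mpre.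
  by apply: reweighted_marginal => // w; exact: ltW.
Qed.

End iterative_DCI_densities.

(** * Convergence to the I-projection *)

Section iterative_DCI_limit.
Context d (T : measurableType d) (R : realType) (k : nat)
  (dD : 'I_k -> measure_display) (D : forall i, measurableType (dD i)).
Variables (phi : forall i, {mfun T >-> D i}) (Pobs : forall i, probability (D i) R)
  (Pinit : probability T R) (P : nat -> probability T R) (g : nat -> T -> R).
Hypothesis k_gt0 : (0 < k)%N.
Local Notation idx := (constraint k_gt0).
Hypothesis P0 : P 0%N = Pinit.
Hypothesis bg : forall n, bmfun (g n).
Hypothesis g_factor : forall n,
  exists2 gam : D (idx n) -> R, bmfun gam & g n = gam \o phi (idx n).
Hypothesis P_rec : forall n A, measurable A ->
  P n.+1 A = \int[P n]_(x in A) (expR (g n x))%:E.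
Hypothesis P_marginal : forall n B, measurable B ->
  distribution (P n.+1) (phi (idx n)) B = Pobs (idx n) B.

Local Notation p := (scaling_density g).
Local Notation S := (total_gain Pinit g).
Local Notation eps := (scaling_gain Pinit g).
Local Notation Ex := (Rintegral Pinit setT).

Let mpre i B : measurable B -> measurable (phi i @^-1` B).
Proof. by move=> mB; exact: measurable_funPTI. Qed.

Let mp n : measurable_fun setT (p n).
Proof. by have [] := bmfun_scaling_density bg n. Qed.

Let p0 n x : (0 <= p n x)%R. Proof. exact: expR_ge0. Qed.

Let lty_setT (Q : probability T R) : Q setT < +oo.
Proof. by apply: le_lt_trans (ltry 1); exact: probability_le1. Qed.

Lemma iterate_density n : has_density (P n) Pinit (p n).
Proof.
elim: n => [|n IH] A mA.
  rewrite P0 (eq_integral (cst 1)) ?integral_cst ?mul1e// => x _.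
  by rewrite /scaling_density big_ord0 expR0.
transitivity (\int[P n]_(x in A) (expR (g n x))%:E); first exact: P_rec.
rewrite integral_mkcond.
rewrite (ge0_density_integral (lty_setT _) (mp n) (p0 n) IH); last 2 first.
- apply/(measurable_restrictT _ mA)/measurable_EFinP/measurable_funTS.
  by have [] := bmfun_exp (bg n).
- by move=> x; rewrite patchE; case: ifPn => // _; rewrite lee_fin expR_ge0.
rewrite [RHS]integral_mkcond; apply: eq_integral => x _; rewrite !patchE.
case: ifPn => xA; last by rewrite mul0e.
by rewrite -EFinM scaling_densityS mulrC.
Qed.

Lemma Ex_density (Q : probability T R) (f h : T -> R) : measurable_fun setT f ->
  (forall x, 0 <= f x)%R -> has_density Q Pinit f -> measurable_fun setT h ->
  Ex (fun x => h x * f x)%R = Rintegral Q setT h.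
Proof.
by move=> mf f0 Qf mh; rewrite /Rintegral (density_integral (lty_setT Q) mf f0 Qf).
Qed.

Lemma Rintegral_marginal (Q : probability T R) i (gam : D i -> R) : bmfun gam ->
  (forall B, measurable B -> distribution Q (phi i) B = Pobs i B) ->
  Rintegral Q setT (gam \o phi i) = Rintegral (Pobs i) setT gam.
Proof.
move=> bgam Qi; congr fine.
rewrite [RHS](eq_measure_integral (distribution Q (phi i))); last first.
  by move=> B mB _; exact/esym/Qi.
have intg : Q.-integrable setT (EFin \o (gam \o phi i)).
  apply: bmfun_integrable; case: bgam => mgam [c gamc].
  by split; [exact: measurableT_comp mgam _|exists c => x; exact: gamc].
rewrite (integral_distribution (f := EFin \o gam))//.
by apply/measurable_EFinP; have [] := bgam.
Qed.

Lemma Ex_scaling_density n : Ex (p n) = 1%R.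
Proof.
by rewrite /Rintegral -(iterate_density n measurableT) [X in fine X]probability_setT.
Qed.

Lemma idx_modn m n : m = n %[mod k] -> idx m = idx n.
Proof. by move=> mn; apply: val_inj. Qed.

(** [F (g m x)] is a function of [phi (idx m) x], so its integral depends on the law only through
    that marginal, which is the observed one for [Q] as for [P m.+1]. Both [Ex_cycle] and the
    balance of feasible densities follow. *)
Lemma Ex_gcomp m (Q : probability T R) (f : T -> R) (F : R -> R) : continuous F ->
  measurable_fun setT f -> (forall x, 0 <= f x)%R -> has_density Q Pinit f ->
  (forall B, measurable B -> distribution Q (phi (idx m)) B = Pobs (idx m) B) ->
  Ex (fun x => F (g m x) * f x)%R = Ex (fun x => F (g m x) * p m.+1 x)%R.
Proof.
move=> cF mf f0 Qf Qi; have [gam bgam gE] := g_factor m.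
have bF : bmfun (fun w => F (gam w)) by exact: bmfun_comp.
have mF : measurable_fun setT (fun x => F (g m x)).
  by have [] := bmfun_comp cF (bg m).
have gF : (fun x => F (g m x)) = (fun w => F (gam w)) \o phi (idx m) by rewrite gE.
rewrite (Ex_density mf f0 Qf mF) (Ex_density (mp _) (p0 _) (@iterate_density m.+1) mF) gF.
by rewrite !(Rintegral_marginal bF)//; exact: P_marginal.
Qed.

Lemma Ex_cycle m n (F : R -> R) : m = n %[mod k] -> continuous F ->
  Ex (fun x => F (g m x) * p n.+1 x)%R = Ex (fun x => F (g m x) * p m.+1 x)%R.
Proof.
move=> mn cF; apply: (Ex_gcomp cF (mp _) (p0 _) (@iterate_density n.+1)).
by rewrite (idx_modn mn); exact: P_marginal.
Qed.

Lemma feasible_density Q : feasible phi Pobs Pinit Q ->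
  exists2 f, has_density Q Pinit f & balanced Pinit g f.
Proof.
move=> [QP0 Qobs]; have [f [mf f0 Qf]] := exists_density (lty_setT Q) QP0.
exists f => //; have f1 : \int[Pinit]_x (f x)%:E = 1.
  by rewrite -Qf//; exact: probability_setT.
split => //.
- apply/integrableP; split; first exact/measurable_EFinP.
  under eq_integral do rewrite gee0_abs ?lee_fin//=.
  by rewrite f1 ltry.
- by rewrite /Rintegral f1.
- move=> m; apply: (@Ex_gcomp m Q f id) => //.
    by move=> x; exact: cvg_id.
  by move=> B mB; exact: Qobs.
Qed.

Hypothesis KL_fin :
  ereal_inf [set KL P' Pinit | P' in feasible phi Pobs Pinit] < +oo.

Lemma KL_balanced (Q : probability T R) f : has_density Q Pinit f -> balanced Pinit g f ->
  KL Q Pinit = \int[Pinit]_x (f x * ln (f x))%:E.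
Proof. by move=> Qf [mf f0 _ _ _]; exact: KL_density. Qed.

Lemma total_gain_le_KL Q n : feasible phi Pobs Pinit Q -> (S n)%:E <= KL Q Pinit.
Proof.
move=> /feasible_density[f Qf bf]; rewrite (KL_balanced Qf bf).
apply: le_trans (hellinger_le_entropy_gap bg Ex_scaling_density n bf).
rewrite leeDl//; apply: integral_ge0 => x _.
by rewrite lee_fin sqr_ge0.
Qed.

Lemma S_bounded : exists B, forall n, (S n <= B)%R.
Proof.
have [_ [Q Qfeas <-] KLoo] := ereal_inf_lt KL_fin.
have KLfin : KL Q Pinit \is a fin_num.
  rewrite fin_numElt KLoo andbT (lt_le_trans _ (total_gain_le_KL 0 Qfeas))//.
  by rewrite ltNyr.
by exists (fine (KL Q Pinit)) => n; rewrite -lee_fin fineK// total_gain_le_KL.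
Qed.

Lemma marginal_eq n i B : idx n = i -> measurable B ->
  distribution (P n.+1) (phi i) B = Pobs i B.
Proof. by move=> ni; move: B; rewrite -ni; exact: P_marginal. Qed.

Lemma Ex_indic (Q : probability T R) (f : T -> R) A : measurable_fun setT f ->
  (forall x, 0 <= f x)%R -> has_density Q Pinit f -> measurable A ->
  Ex (fun x => \1_A x * f x)%R = fine (Q A).
Proof.
move=> mf f0 Qf mA; rewrite (Ex_density mf f0 Qf) /Rintegral; last exact: measurable_indic.
by rewrite integral_indic// setIT.
Qed.

Theorem iterative_DCI_cvg : exists2 Pinf : probability T R,
  (tv_dist (P n) Pinf @[n --> \oo] --> 0) &
  is_Iprojection (feasible phi Pobs Pinit) Pinit Pinf.
Proof.
have cS := is_cvg_total_gain bg Ex_scaling_density S_bounded.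
have [f [mf f0 pf fM]] := scaling_limit k_gt0 bg Ex_scaling_density Ex_cycle S_bounded.
have intf := limit_integrable bg mf pf.
have bf := limit_balanced k_gt0 bg Ex_scaling_density Ex_cycle mf f0 pf.
have entf := limit_entropy k_gt0 bg Ex_scaling_density Ex_cycle S_bounded mf f0 pf fM.
have intp n : Pinit.-integrable setT (EFin \o p n) by exact/bmfun_integrable/bmfun_scaling_density.
have f1 : \int[Pinit]_x (f x)%:E = 1.
  by rewrite -EFin_Rint//; have [_ _ _ -> _] := bf.
have [Pinf Pf] := exists_probability_of_density mf f0 f1.
have tv e : (0 < e)%R -> exists n0, forall n, (n0 <= n)%N -> tv_dist (P n) Pinf <= e%:E.
  move=> /pf[n0 n0P]; exists n0 => n n0n.
  exact: tv_dist_le (@iterate_density n) Pf (intp n) intf (n0P n n0n).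
have KLf : KL Pinf Pinit <= (limn S)%:E by rewrite (KL_balanced Pf bf).
have feasf : feasible phi Pobs Pinit Pinf.
  split; first exact: density_null_dominates Pf.
  move=> i B mB; have mA := mpre mB; set A := phi i @^-1` B in mA.
  transitivity (Pinf A); first by [].
  rewrite -[LHS]fineK ?fin_num_measure// -[RHS]fineK ?fin_num_measure//.
  congr EFin; rewrite -(Ex_indic mf f0 Pf mA).
  (* Test the limit on the indicator of [A], whose integral is exact after every step that uses
     constraint [i]. *)
  apply: (limit_Ex bg mf pf).
    split; first exact: measurable_indic.
    by exists 1%R => x; rewrite indicE ger0_norm ?ler0n// lern1 leq_b1.
  move=> n0; exists (i + n0 * k).+1.
    by rewrite leqW// (leq_trans (leq_pmulr n0 k_gt0))// leq_addl.
  rewrite (Ex_indic (mp _) (p0 _) (@iterate_density _) mA).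
  rewrite -(@marginal_eq (i + n0 * k) i)//; apply: val_inj => /=.
  by rewrite addnC modnMDl modn_small.
(* The divergence of a feasible law is at least every [S n], hence at least their limit, which
   bounds the divergence of [Pinf] by [KLf]. *)
have KLle Q : feasible phi Pobs Pinit Q -> KL Pinf Pinit <= KL Q Pinit.
  move=> Qfeas; apply: (le_trans KLf); have SQ n := total_gain_le_KL n Qfeas.
  case: (KL Q Pinit) SQ => [r| |] SQ.
  - rewrite lee_fin; apply: limr_le => //; apply: nearW => n.
    by rewrite -lee_fin.
  - by rewrite leey.
  - by have := SQ 0%N; rewrite leNgt ltNyr.
exists Pinf.
  have tvfin : \forall n \near \oo, tv_dist (P n) Pinf \is a fin_num.
    have [n0 n0P] := tv 1%R ltr01; exists n0 => // n n0n.
    by rewrite ge0_fin_numE ?tv_dist_ge0// (le_lt_trans (n0P n n0n)) ?ltry.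
  apply/fine_cvgP; split => //; apply/cvgrPdist_le => e e0.
  have [n0 n0P] := tv e e0; near=> n.
  rewrite sub0r normrN ger0_norm ?fine_ge0 ?tv_dist_ge0// -lee_fin fineK; last by near: n.
  by apply: n0P; near: n; exists n0.
split => // Q Qfeas QKL A mA; have [h Qh bh] := feasible_density Qfeas.
have [mh h0 inth h1 _] := bh.
(* A competitor that does no worse than [Pinf] has divergence at most [limn S], so its density is
   Hellinger-close to [p n] for late [n]. *)
have hellS n : \int[Pinit]_x (sqr_hellinger h (p n) x)%:E <= (limn S - S n)%:E.
  rewrite EFinB leeBrDl//; apply: le_trans (hellinger_le_entropy_gap bg Ex_scaling_density n bh) _.
  by rewrite -(KL_balanced Qh bh) (le_trans QKL).
rewrite -[LHS]fineK ?fin_num_measure// -[RHS]fineK ?fin_num_measure//; congr EFin.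
apply/eqP; rewrite -subr_eq0 -normr_eq0 eq_le normr_ge0 andbT.
apply/ler_addgt0Pr => e e0; rewrite add0r.
(* [3 * (e / 4)] is for the distance from [Q] to [P n], through [integral_normB_le], and [e / 4] for
   that from [P n] to [Pinf]. *)
have e4 : (0 < e / 4)%R by exact: divr_gt0.
have [n1 n1P] := tv _ e4.
have /cvgrPdist_le/(_ _ (exprn_gt0 2 e4))[n2 _ n2P] := cS.
pose n := maxn n1 n2.
have Qn : \int[Pinit]_x (`|h x - p n x|)%:E <= (3 * (e / 4))%:E.
  apply: integral_normB_le => //.
  - by rewrite -EFin_Rint// h1.
  - by rewrite -EFin_Rint// Ex_scaling_density.
  - apply: (le_trans (hellS n)); rewrite lee_fin.
    exact: le_trans (ler_norm _) (n2P n (leq_maxr _ _)).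
have d1 := le_trans (density_dist Qh (@iterate_density n) inth (intp n) mA) Qn.
have d2 := le_trans (le_tv_dist (P n) Pinf mA) (n1P n (leq_maxl _ _)).
have absE (Q1 Q2 : probability T R) :
    `|Q1 A - Q2 A| = (`|fine (Q1 A) - fine (Q2 A)|%R)%:E.
  have := fineK (fin_num_measure Q1 A mA); have := fineK (fin_num_measure Q2 A mA).
  by move=> {1}<- {1}<-.
move: d1 d2; rewrite !absE !lee_fin.
move=> d1 d2; rewrite -(subrK (fine (P n A)) (fine (Q A))) -addrA.
rewrite (le_trans (ler_normD _ _))//; lra.
Unshelve. all: by end_near. Qed.

End iterative_DCI_limit.

(** Points are closed in a metric space. This makes the fibres of [phi i] measurable, as
    [kernel_fiber] requires. *)
Lemma borel_measurable_set1 (R : realType) (T : completeMetricType R) (w : borel T) :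
  measurable [set w].
Proof.
rewrite -[X in measurable X]setCK; apply: measurableC; apply: sub_sigma_algebra.
rewrite /= openC.
exact: (accessible_closed_set1 (hausdorff_accessible (@metric_hausdorff R T))).
Qed.

Theorem theorem5p1 (R : realType) (k : nat) (k_gt0 : (0 < k)%N)
  (p : nat) (Lam : completeMetricType R) (Lam_sep : separable Lam)
  (iota : Lam -> 'rV[R]_p) (Lam_sub : embedding iota)
  (dim : 'I_k -> nat) (D : 'I_k -> completeMetricType R)
  (D_sep : forall i, separable (D i))
  (iotaD : forall i, D i -> 'rV[R]_(dim i))
  (D_sub : forall i, embedding (iotaD i))
  (phi : forall i, {mfun borel Lam >-> borel (D i)})
  (Pobs : forall i, probability (borel (D i)) R)
  (Pinit : probability (borel Lam) R)
  (P : nat -> probability (borel Lam) R)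
  (P_DCI : iterative_DCI phi Pobs Pinit P)
  (feas : exists2 P', feasible phi Pobs Pinit P' & P' `<< Pinit)
  (KL_fin : ereal_inf [set KL P' Pinit | P' in feasible phi Pobs Pinit] < +oo)
  (C : R) (C_gt0 : (0 < C)%R)
  (density_bounds : forall i,
     {ae distribution Pinit (phi i), forall w,
        (C^-1)%:E <=
          ('d (charge_of_finite_measure (Pobs i)) '/d (distribution Pinit (phi i))) w
          <= C%:E}) :
  exists2 Pinf : probability (borel Lam) R,
    (tv_dist (P n) Pinf @[n --> \oo] --> 0) &
    is_Iprojection (feasible phi Pobs Pinit) Pinit Pinf.
Proof.
have feas' : exists P', feasible phi Pobs Pinit P'.
  by case: feas => P' P'feas _; exists P'.
have point_meas i := @borel_measurable_set1 R (D i).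
have [g gP] := exists_log_ratios k_gt0 point_meas P_DCI feas' C_gt0 density_bounds.
have [P0 _] := P_DCI.
apply: (@iterative_DCI_cvg _ _ _ _ _ _ phi Pobs Pinit P g k_gt0) => // n;
  by have [] := gP n.
Qed.
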